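(* Let $T\ge 1$ and $N\ge 1$ be integers, $\epsilon>0$, $m\in\mathbb{R}$, and let $\sigma^2$ be the noise variance. Let $u_o$ be the optimal closed-loop controller of the one-dimensional LQR problem described in the context, and let $u_v,u_d,u_p$ be the (random) closed-loop controllers learned under Model 1 by the vanilla method, by DAgger and by POPS respectively, as defined in the context. Let $\hat x^v(t),\hat x^d(t),\hat x^p(t)$ be the associated training-data state variables, also defined in the context. For $s\in\{o,v,d,p\}$ define $x_s$ on $[0,T]$ by $$\dot x_s(t)=u_s(t)=u_s(t,x_s(t)),\qquad x_s(0)=x_{\mathrm{init}},\qquad 0\le t\le T,$$ where $u_s(t):=u_s(t,x_s(t))$. 1. (Distribution difference) Assume $x_{\mathrm{init}}$ is a random variable with the standard normal distribution, independent of the initial points and noises in the training process. Then for $0\le t\le T$, $\mathbb{E}\hat x^v(t)=\mathbb{E}x_v(t)$, $\mathbb{E}\hat x^p(t)=\mathbb{E}x_p(t)$, and $$|\mathrm{Var}(\hat x^v(t))-\mathrm{Var}(x_v(t))|=\epsilon^2\sigma^2\Bigl(1-\frac{1}{NT}\Bigr)t^2,$$ $$\mathrm{Var}(\hat x^d(t))-\mathrm{Var}(x_d(t))\ge \epsilon^2\sigma^2\Bigl(\frac{t^2}{3}-\frac{2t}{N}\Bigr),$$ $$|\mathrm{Var}(\hat x^p(t))-\mathrm{Var}(x_p(t))|\le \epsilon^2\sigma^2 .$$ 2. (Performance difference) Assume $x_{\mathrm{init}}\in\mathbb{R}$ is fixed (deterministic) and define the total cost $$J_s=\frac1T\int_0^T|u_s(t)|^2\,\mathrm{d}t+|x_s(T)|^2,\qquad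 s\in\{o,v,d,p\}.$$ Then, with expectation taken over the training initial points and noises, $$\mathbb{E}J_v-J_o=(T^2+1)\Bigl(m^2+\frac{\sigma^2}{NT}\Bigr)\epsilon^2,$$ $$\mathbb{E}J_d-J_o\ge\Bigl(\frac{T^2m^2}{4}+\frac{T\sigma^2}{3N}\Bigr)\epsilon^2,$$ $$\mathbb{E}J_p-J_o\le 3\Bigl(m^2+\frac{\sigma^2}{N}\Bigr)\epsilon^2 .$$
   Context: **LQR problem.** For a positive integer $T$, $t_0\in[0,T]$, $x_0\in\mathbb{R}$: minimize $\frac1T\int_{t_0}^T|u(t)|^2\,\mathrm{d}t+|x(T)|^2$ subject to $\dot x(t)=u(t)$ on $[t_0,T]$, $x(t_0)=x_0$. The open-loop optimal control is the constant $u^*(t;t_0,x_0)=-\frac{T}{T(T-t_0)+1}x_0$, and the closed-loop optimal control is $u_o(t,x)=-\frac{T}{T(T-t)+1}x$. **Model 1.** Learned closed-loop controllers have the form $u_\theta(t,x)=-\frac{T}{T(T-t)+1}x+b(t)$, with parameter $\theta=\{b(t)\}_{0\le t\le T}$. In every least-squares problem below, the value $b(t)$ is optimized independently for each $t$ (i.e. $b(t)$ minimizes the integrand at time $t$). Ordinary differential equations with such (piecewise continuous in $t$) controllers are understood with continuous, piecewise $C^1$ solutions. **Noisy open-loop solver.** Starting from $(t_0,x_0)$, the solver returns on $[t_0,T]$ the approximate optimal path $$\hat u(t;t_0,x_0)=-\tfrac{T}{T(T-t_0)+1}x_0+\epsilon Z,\qquad \hat x(t;t_0,x_0)=\tfrac{T(T-t)+1}{T(T-t_0)+1}x_0+(t-t_0)\epsilon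 Z,$$ where $Z$ is normal with mean $m$ and variance $\sigma^2$. The noises $Z$ used for different paths are i.i.d. and independent of the sampled initial points at time $0$. In all three methods the initial points at time $0$ are independent standard normal samples. **Vanilla method.** Sample $NT$ initial points $\tilde x^v_j$, $1\le j\le NT$, and compute the paths from time $0$ with noises $Z^v_j$: $$\hat u^v_j(t)=-\tfrac{T}{T^2+1}\tilde x^v_j+\epsilon Z^v_j,\qquad \hat x^v_j(t)=\tfrac{T(T-t)+1}{T^2+1}\tilde x^v_j+\epsilon tZ^v_j,\qquad t\in[0,T].$$ The controller $u_v$ is $u_\theta$ with $\theta$ minimizing $\int_0^T\sum_{j=1}^{NT}|\hat u^v_j(t)-u_\theta(t,\hat x^v_j(t))|^2\,\mathrm{d}t$. **DAgger (single iteration, temporal grid points $t_i=i$).** - Sample $N$ initial points $\tilde x^d_{0,j}$, $1\le j\le N$, and compute the paths from time $0$ with noises $Z^d_{0,j}$: $\hat u^d_{0,j}(t)=-\frac{T}{T^2+1}\tilde x^d_{0,j}+\epsilon Z^d_{0,j}$, $\hat x^d_{0,j}(t)=\frac{T(T-t)+1}{T^2+1}\tilde x^d_{0,j}+\epsilon tZ^d_{0,j}$ on $[0,T]$. - Let $u_0$ be the Model 1 controller minimizing $\int_0^T\sum_{j=1}^N|\hat u^d_{0,j}(t)-u_\theta(t,\hat x^d_{0,j}(t))|^2\,\mathrm{d}t$. - Solve $\dot x^d_{0,j}(t)=u_0(t,x^d_{0,j}(t))$, $x^d_{0,j}(0)=\tilde x^d_{0,j}$ on $[0,T]$, and set $\tilde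 x^d_{i,j}=x^d_{0,j}(i)$ for $i=1,\dots,T-1$. - For $1\le i\le T-1$, $1\le j\le N$, compute the paths on $[i,T]$ with noises $Z^d_{i,j}$: $\hat u^d_{i,j}(t)=-\frac{T}{T(T-i)+1}\tilde x^d_{i,j}+\epsilon Z^d_{i,j}$, $\hat x^d_{i,j}(t)=\frac{T(T-t)+1}{T(T-i)+1}\tilde x^d_{i,j}+(t-i)\epsilon Z^d_{i,j}$. - The controller $u_d$ is $u_\theta$ with $\theta$ minimizing, for each $i=0,\dots,T-1$, $\int_i^{i+1}\sum_{k=0}^i\sum_{j=1}^N|\hat u^d_{k,j}(t)-u_\theta(t,\hat x^d_{k,j}(t))|^2\,\mathrm{d}t$ (for $t\in[i,i+1)$ all paths $k=0,\dots,i$ are used; at $t=T$ take $i=T-1$). **POPS (temporal grid points $t_i=i$).** - Sample $N$ initial points $\tilde x^p_{0,j}$, $1\le j\le N$, and set $\theta^{-1}=0$. - For $i=0,1,\dots,T-1$: solve $\dot x^p_{i,j}(t)=u_{\theta^{i-1}}(t,x^p_{i,j}(t))$, $x^p_{i,j}(0)=\tilde x^p_{0,j}$ on $[0,i]$, and set $\tilde x^p_{i,j}=x^p_{i,j}(i)$. Compute the paths on $[i,T]$ with noises $Z^p_{i,j}$: $\hat u^p_{i,j}(t)=-\frac{T}{T(T-i)+1}\tilde x^p_{i,j}+\epsilon Z^p_{i,j}$, $\hat x^p_{i,j}(t)=\frac{T(T-t)+1}{T(T-i)+1}\tilde x^p_{i,j}+(t-i)\epsilon Z^p_{i,j}$.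 For $i\ge1$ and $t\in[0,i)$ set $\hat u^p_{i,j}(t)=\hat u^p_{i-1,j}(t)$ and $\hat x^p_{i,j}(t)=\hat x^p_{i-1,j}(t)$. Let $\theta^i$ minimize $\int_0^T\sum_{j=1}^N|\hat u^p_{i,j}(t)-u_\theta(t,\hat x^p_{i,j}(t))|^2\,\mathrm{d}t$. - The controller is $u_p=u_{\theta^{T-1}}$. **Training-data state variables.** $\hat x^v(t),\hat x^d(t),\hat x^p(t)$ are random variables whose distributions are the average distributions of the states in the (final) training data at time $t$. That is: - the law of $\hat x^v(t)$ is $\frac{1}{NT}\sum_{j=1}^{NT}\mathrm{Law}(\hat x^v_j(t))$; - for $t\in[i,i+1)$ (with $i=T-1$ for $t=T$), the law of $\hat x^d(t)$ is $\frac{1}{N(i+1)}\sum_{k=0}^i\sum_{j=1}^N\mathrm{Law}(\hat x^d_{k,j}(t))$; - the law of $\hat x^p(t)$ is $\frac1N\sum_{j=1}^N\mathrm{Law}(\hat x^p_{T-1,j}(t))$. *)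

(* Defs.v *)
From HB Require Import structures.
From mathcomp Require Import all_boot all_order all_algebra.
From mathcomp Require Import all_classical all_reals all_analysis.

Set Implicit Arguments.
Unset Strict Implicit.
Unset Printing Implicit Defensive.

Import Order.TTheory GRing.Theory Num.Theory.
Import numFieldNormedType.Exports.

Local Open Scope classical_set_scope.
Local Open Scope ring_scope.

Section Probability.
Context {R : realType} {d : measure_display} {W : measurableType d}.
Variable P : probability W R.

(* [normal_prob m 0] is the uniform law on [0, 1] (junk value); the normal law
   with variance 0 is the point mass at m. *)
Definition normal_law (m sigma : R) : set R -> \bar R :=
  if sigma == 0 then \d_m else normal_prob m sigma.

Definition has_normal_law (m sigma : R) (X : {RV P >-> R}) : Prop :=
  forall A : set R, measurable A -> distribution P X A = normal_law m sigma A.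

(* Taking some of the A i equal to setT gives the product rule for all
   subfamilies. *)
Definition mutually_independent (I : finType) (X : I -> W -> R) : Prop :=
  forall A : I -> set R, (forall i, measurable (A i)) ->
    P (\bigcap_(i in [set: I]) (X i @^-1` A i)) =
    (\prod_(i : I) P (X i @^-1` A i))%E.

(* The finite intersections form a pi-system generating the sigma-algebra of
   the family X. *)
Definition independent_of_family (I : finType) (Y : W -> R) (X : I -> W -> R)
    : Prop :=
  forall (B : set R) (A : I -> set R),
    measurable B -> (forall i, measurable (A i)) ->
    P ((Y @^-1` B) `&` \bigcap_(i in [set: I]) (X i @^-1` A i)) =
    (P (Y @^-1` B) * P (\bigcap_(i in [set: I]) (X i @^-1` A i)))%E.

Definition joint_family (I J : finType) (X : I -> {RV P >-> R})
    (Z : J -> {RV P >-> R}) (k : I + J) : W -> R :=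
  match k with inl i => X i | inr j => Z j end.

(* X: initial points at time 0; Z: noises of the solver, one for each path. *)
Record training_sample (m sigma : R) (I J : finType) (X : I -> {RV P >-> R})
    (Z : J -> {RV P >-> R}) : Prop := TrainingSample {
  sample_init : forall i, has_normal_law 0 1 (X i);
  sample_noise : forall j, has_normal_law m sigma (Z j);
  sample_indep : mutually_independent (joint_family X Z)
}.

(* The law of Y is the average of the n laws of the X i with i in K
   (n = #|K| in all uses). *)
Definition has_average_law {d' : measure_display} {W' : measurableType d'}
    (Q : probability W' R) (Y : {RV Q >-> R})
    (I : finType) (K : pred I) (n : nat) (X : I -> W -> R) : Prop :=
  forall A : set R, measurable A ->
    distribution Q Y A =
    ((n%:R^-1)%:E * \sum_(i | K i) P (X i @^-1` A))%E.

End Probability.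

Section Control.
Context {R : realType}.
Implicit Types (T N : nat) (eps t x z : R).

Definition lqr_cost T (t0 : R) (u x : R -> R) : R :=
  T%:R^-1 * (\int[lebesgue_measure]_(t in `[t0, T%:R]) (`|u t| ^+ 2))
  + `|x T%:R| ^+ 2.

(* - gain T t * x is the optimal closed-loop control for minimizing
   [lqr_cost T t0 u x] subject to x' = u and x(t0) = x0. *)
Definition gain T t : R := T%:R / (T%:R * (T%:R - t) + 1).

Definition optimal_feedback T t x : R := - gain T t * x.

(* The parameter of the controller is the function b. *)
Definition model1 T (b : R -> R) t x : R := - gain T t * x + b t.

(* Continuous, piecewise C^1 solution on [0, a] of x' = u(t, x), x(0) = x0:
   s is a finite set of breakpoints, where x' has one-sided limits only. *)
Record ode_solution (a : R) (u : R -> R -> R) (x0 : R) (x : R -> R) : Prop :=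
  OdeSolution {
  ode_init : x 0 = x0;
  ode_continuous : {within `[0, a], continuous x};
  ode_piecewise : exists s : seq R,
    [/\ forall t, t \in `]0, a[ -> t \notin s ->
          is_derive t (1 : R) x (u t (x t)) /\ {for t, continuous (derive1 x)},
        forall t, t \in `[0, a[ -> cvg (derive1 x @ t^'+) &
        forall t, t \in `]0, a] -> cvg (derive1 x @ t^'-)]
}.

(* Noisy open-loop solver started at (t0, x0), with noise z. *)
Definition solver_u T eps (t0 x0 z t : R) : R :=
  - (T%:R / (T%:R * (T%:R - t0) + 1)) * x0 + eps * z.

Definition solver_x T eps (t0 x0 z t : R) : R :=
  (T%:R * (T%:R - t) + 1) / (T%:R * (T%:R - t0) + 1) * x0
  + (t - t0) * eps * z.

Definition square_loss (I : finType) (K : pred I) (uhat xhat : I -> R -> R)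
    (u : R -> R -> R) t : R :=
  \sum_(i | K i) `|uhat i t - u t (xhat i t)| ^+ 2.

(* The data in use at time t are those with index in K t; the value b t is
   optimized for each t separately. *)
Definition least_squares T (I : finType) (K : R -> pred I)
    (uhat xhat : I -> R -> R) (b : R -> R) : Prop :=
  forall t, t \in `[0, T%:R] -> forall b' : R -> R,
    square_loss (K t) uhat xhat (model1 T b) t <=
    square_loss (K t) uhat xhat (model1 T b') t.

(* The i < T with t in [i, i+1), and T - 1 at t = T. *)
Definition stage T t : nat := minn (Num.truncn t) T.-1.

(* In the rest of the section all quantities are those of one realization:
   X are the sampled initial points, Z the noises; only Z k with k < T
   is used. *)

Section Vanilla.
Variables (T N : nat) (eps : R) (X Z : 'I_(N * T) -> R).

Definition vanilla_u (j : 'I_(N * T)) : R -> R := solver_u T eps 0 (X j) (Z j).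
Definition vanilla_x (j : 'I_(N * T)) : R -> R := solver_x T eps 0 (X j) (Z j).

Definition vanilla_run (b : R -> R) : Prop :=
  least_squares T (fun=> xpredT) vanilla_u vanilla_x b.

End Vanilla.

Section DAgger.
Variables (T N : nat) (eps : R) (X : 'I_N -> R) (Z : nat -> 'I_N -> R).

(* x j: the trajectory of the first controller from X j *)
Definition dagger_start (x : 'I_N -> R -> R) (i : nat) (j : 'I_N) : R :=
  if i == 0%N then X j else x j i%:R.

Definition dagger_u (x : 'I_N -> R -> R) (k : nat) (j : 'I_N) : R -> R :=
  solver_u T eps k%:R (dagger_start x k j) (Z k j).

Definition dagger_x (x : 'I_N -> R -> R) (k : nat) (j : 'I_N) : R -> R :=
  solver_x T eps k%:R (dagger_start x k j) (Z k j).

Definition dagger_data T t : pred ('I_T * 'I_N) :=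
  fun kj => (kj.1 <= stage T t)%N.

(* b0, b: parameters of the first and of the final controller *)
Record dagger_run (b0 : R -> R) (x : 'I_N -> R -> R) (b : R -> R) : Prop :=
  DaggerRun {
  dagger_fit0 :
    least_squares T (fun=> xpredT) (dagger_u x 0) (dagger_x x 0) b0;
  dagger_ode : forall j, ode_solution T%:R (model1 T b0) (X j) (x j);
  dagger_fit : least_squares T (@dagger_data T)
    (fun kj : 'I_T * 'I_N => dagger_u x kj.1 kj.2)
    (fun kj : 'I_T * 'I_N => dagger_x x kj.1 kj.2) b
}.

End DAgger.

Section POPS.
Variables (T N : nat) (eps : R) (X : 'I_N -> R) (Z : nat -> 'I_N -> R).

(* x i j: the trajectory from X j, on [0, i], of the controller of
   iteration i - 1 *)
Fixpoint pops_u (x : nat -> 'I_N -> R -> R) (i : nat) (j : 'I_N) t : R :=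
  let path := solver_u T eps i%:R (x i j i%:R) (Z i j) t in
  if i is i'.+1 then if t < i%:R then pops_u x i' j t else path else path.

Fixpoint pops_x (x : nat -> 'I_N -> R -> R) (i : nat) (j : 'I_N) t : R :=
  let path := solver_x T eps i%:R (x i j i%:R) (Z i j) t in
  if i is i'.+1 then if t < i%:R then pops_x x i' j t else path else path.

Definition pops_prev (b : nat -> R -> R) (i : nat) : R -> R :=
  if i is i'.+1 then b i' else fun=> 0.

(* b i: the parameter obtained at iteration i; that of the final controller
   is b T.-1 *)
Record pops_run (x : nat -> 'I_N -> R -> R) (b : nat -> R -> R) : Prop :=
  PopsRun {
  pops_ode : forall i j, (i < T)%N ->
    ode_solution i%:R (model1 T (pops_prev b i)) (X j) (x i j);
  pops_fit : forall i, (i < T)%N ->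
    least_squares T (fun=> xpredT) (pops_u x i) (pops_x x i) (b i)
}.

End POPS.

End Control.

(* Main.v *)
(** With h(t) = T (T - t) + 1, a path started at time t0 with noise z leaves the
    residual eps h(t0) z / h(t) in the regression for b(t). Hence b = c_i / h on
    each stage [i, i+1), where c_i is a linear combination of the noises: its
    weights are eps h(0) / (N T) for the vanilla method, eps h(i) / N on the paths
    started at i for POPS, and eps h(k) / (N (i+1)) on those started at k <= i for
    DAgger. Since (x / h)' = c_i / h^2 = (c_i / T) (1 / h)' on each stage, x(t) is
    an explicit linear combination of the initial point and the noises. Moreover u
    is constant on each stage, and the cost is
    x0^2 / h(0) + sum_i c_i^2 / (T h(i) h(i+1)).

    For DAgger, let a_k(t) be the coefficient of eps times the mean noise of the
    paths started at k. The lower bound (i+1) a_k(t) >= t - k bounds its slope by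
    1 / (i+1), so a_k is at most a tail of the harmonic series, and these tails
    satisfy sum_k a_k(t)^2 <= 2 t. For the cost of DAgger the last term of the sum
    is large enough. *)

Require Import Defs.
From HB Require Import structures.
From mathcomp Require Import all_boot all_order all_algebra.
From mathcomp Require Import all_classical all_reals all_analysis.
From mathcomp Require Import measurable_realfun ring lra.

Set Implicit Arguments.
Unset Strict Implicit.
Unset Printing Implicit Defensive.

Import Order.TTheory GRing.Theory Num.Theory.
Import numFieldNormedType.Exports.

Local Open Scope classical_set_scope.
Local Open Scope ring_scope.

(** * Moments of the normal law *)

Section GaussMoments.
Context {R : realType}.
Local Notation mu := (@lebesgue_measure R).
Local Notation g := (@gauss_fun R).

(** Every quantity in the theorem is at most quadratic in linear combinations of one initial point
    and the noises. Normality therefore enters only through mean and variance, and independence only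
    through pairs of variables. The training-data variables are of another kind: they live on a
    second probability space and are known only through an average of laws, so their moments come
    from a finite mixture of measures. For the vanilla method and POPS all components of the mixture
    have the same mean and variance, hence exact formulas; for DAgger they differ, and the variance
    of the mixture is only bounded below by the mean of the component variances. A training path
    carries its own noise undivided, while a fitted controller carries averages of noises; this is
    the source of every variance gap. The own noise has acted for the whole time t in the vanilla
    method. In POPS it has acted only since the last restart, for a time at most 1, and all older
    noise is common to the data and the learned trajectory. DAgger keeps the paths of all earlier
    restarts k in its data, and the average of (t - k)^2 over them is at least t^2 / 3. *)

Lemma is_derive_gauss_fun (x : R) : is_derive x 1 g (- (2 * x * g x)).
Proof.
rewrite /gauss_fun.
have h : is_derive x (1 : R) (fun y : R => - y ^+ 2) (- (2 * x)).
  apply: is_derive_eq; rewrite /GRing.scale/=; ring.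
have -> : - (2 * x * expR (- x ^+ 2)) = expR (- x ^+ 2) * - (2 * x) by ring.
exact: (@is_derive1_comp R expR (fun y => - y ^+ 2) x).
Qed.

Lemma gauss_fun_le_inv (x : R) : g x <= (1 + x ^+ 2)^-1.
Proof.
rewrite /gauss_fun expRN lef_pV2 ?posrE ?expR_gt0 ?expR_ge1Dx//.
by rewrite (lt_le_trans ltr01)// lerDl sqr_ge0.
Qed.

Lemma continuous_mul_gauss (f : R -> R) : continuous f ->
  continuous (fun x => f x * g x).
Proof.
by move=> cf x; apply: cvgM; [exact: cf|exact: continuous_gauss_fun].
Qed.

(** The boundary term of the integration by parts below: n g(n) <= n / (1 + n^2) <= 1 / n. *)
Lemma cvg_id_gauss_fun : (n.+1%:R * g n.+1%:R) @[n --> \oo] --> (0 : R).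
Proof.
apply: (@squeeze_cvgr _ _ _ _ (cst 0) (fun n => n.+1%:R^-1 : R)).
- near=> n; apply/andP; split; first by rewrite mulr_ge0 ?gauss_fun_ge0.
  apply: (@le_trans _ _ (n.+1%:R * (1 + n.+1%:R ^+ 2)^-1)).
    by rewrite ler_wpM2l ?gauss_fun_le_inv.
  rewrite ler_pdivrMr; last by rewrite (lt_le_trans ltr01)// lerDl sqr_ge0.
  by rewrite ler_pdivlMl ?ltr0n// -expr2 lerDr.
- exact: cvg_cst.
- exact: cvg_harmonic.
Unshelve. all: by end_near. Qed.

(** Integration by parts of x times x g(x), where - g / 2 is a primitive of x g(x), reduces this to
    half the Gaussian integral. It is done on the bounded intervals [0, n + 1], which are never
    degenerate, and passes to the limit by monotone convergence. *)
Lemma integral0y_sqr_gauss :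
  (\int[mu]_(x in `[0%R, +oo[) (x ^+ 2 * g x)%:E = (Num.sqrt pi / 4)%:E)%E.
Proof.
have csg : continuous (fun x : R => x ^+ 2 * g x).
  by apply: continuous_mul_gauss; exact: exprn_continuous.
have sg0 (x : R) : 0 <= x ^+ 2 * g x.
  by rewrite mulr_ge0 ?sqr_ge0 ?gauss_fun_ge0.
have parts n : (\int[mu]_(x in `[0%R, n.+1%:R]) (x ^+ 2 * g x)%:E =
    (- (n.+1%:R * g n.+1%:R) / 2)%:E +
    2^-1%:E * \int[mu]_(x in `[0%R, n.+1%:R]) (g x)%:E)%E.
  have dG (x : R) : is_derive x 1 (fun y => - g y / 2) (x * g x).
    have dg := is_derive_gauss_fun x.
    by apply: is_derive_eq; rewrite /GRing.scale/=; field.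
  have cG : continuous (fun y => - g y / 2).
    by move=> x; apply: cvgM; [apply: cvgN; exact: continuous_gauss_fun|exact: cvg_cst].
  have c1 : {within `[0, n.+1%:R], continuous (cst (1 : R) : R -> R)}.
    by apply: continuous_subspaceT => x; exact: cvg_cst.
  have cxg : {within `[0, n.+1%:R], continuous (fun x => x * g x)}.
    by apply: continuous_subspaceT; apply: continuous_mul_gauss => x; exact: cvg_id.
  have := @integration_by_parts R id (fun y => - g y / 2) (cst 1)
    (fun x => x * g x) 0 n.+1%:R.
  rewrite ltr0n => /(_ isT).
  move=> /(_ c1).
  have Gid : derivable_oo_LRcontinuous (@id R) 0 n.+1%:R.
    split => [x _||]; first exact: derivable_id.
      exact: cvg_at_right_filter.
    exact: cvg_at_left_filter.
  move=> /(_ Gid).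
  have did : {in `]0, n.+1%:R[, ((@id R)^`())%classic =1 cst 1}.
    by move=> x _; rewrite derive1_id.
  move=> /(_ did cxg).
  have LG : derivable_oo_LRcontinuous (fun y => - g y / 2) 0 n.+1%:R.
    split => [x _||]; first by case: (dG x).
      by apply: cvg_at_right_filter; exact: cG.
    by apply: cvg_at_left_filter; exact: cG.
  have dGE : {in `]0, n.+1%:R[, ((fun y => - g y / 2)^`())%classic =1 (fun x => x * g x)}.
    by move=> x _; rewrite derive1E; have [_ ->] := dG x.
  move=> /(_ LG dGE).
  under eq_integral do rewrite mulrA -expr2.
  move=> ->.
  have ig : mu.-integrable `[0, n.+1%:R] (fun x => (g x)%:E).
    by apply: (integrableS measurableT) => //; exact: integrableT_gauss.
  rewrite [X in (_ - X)%E](_ : _ = \int[mu]_(x in `[0%R, n.+1%:R])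
      ((- 2^-1)%:E * (g x)%:E))%E; last first.
    by apply: eq_integral => x _; rewrite -EFinM /=; congr _%:E; ring.
  rewrite integralZl// mul0r subr0 EFinN mulNe oppeK.
  by congr (_%:E + _)%E; ring.
have /= := @ge0_cvgn_integral R mu _ sg0 (continuous_measurable_fun csg).
rewrite -cvg_shiftS /=; under eq_fun do rewrite parts.
move=> /cvg_lim <- //; apply/cvg_lim => //.
have -> : (Num.sqrt pi / 4)%:E =
    ((- 0 / 2 : R)%:E + 2^-1%:E * (Num.sqrt pi / 2)%:E :> \bar R)%E.
  by rewrite -EFinM -EFinD; congr _%:E; field.
apply: cvgeD => //.
  apply: cvg_EFin; first exact: nearW.
  apply: cvgM; last exact: cvg_cst.
  by apply: cvgN; exact: cvg_id_gauss_fun.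
apply: cvgeZl => //.
rewrite -integral0y_gauss.
have /= := @ge0_cvgn_integral R mu _ (@gauss_fun_ge0 R) (@measurable_gauss_fun R).
by rewrite -cvg_shiftS.
Qed.

End GaussMoments.

(** * Expectations under a normal law as integrals against exp(- y^2) *)

Section NormalLawIntegral.
Context {R : realType} {d : measure_display} {W : measurableType d}.
Variable P : probability W R.
Local Notation mu := (@lebesgue_measure R).
Local Notation g := (@gauss_fun R).

(** The Radon-Nikodym derivative of the normal law and its density have the same integral over every
    measurable set, so they agree almost everywhere. *)
Lemma ge0_integral_normal_prob (m s : R) (f : R -> R) : measurable_fun setT f ->
  (forall x, 0 <= f x) ->
  (\int[normal_prob m s]_x (f x)%:E =
   \int[mu]_x ((f x)%:E * (normal_pdf m s x)%:E))%E.
Proof.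
move=> mf f0.
have nmu := @normal_prob_dominates R m s.
have mfE : measurable_fun setT (EFin \o f) by exact/measurable_EFinP.
have mpdf : measurable_fun setT (EFin \o normal_pdf m s).
  by apply/measurable_EFinP; exact: measurable_normal_pdf.
have irn := Radon_Nikodym_SigmaFinite.f_integrable nmu.
rewrite -(Radon_Nikodym_SigmaFinite.change_of_variables nmu)//.
apply: ae_eq_integral => //.
- by apply: emeasurable_funM => //; exact: measurable_int irn.
- exact: emeasurable_funM.
- apply: ae_eqe_mul2l; apply: integral_ae_eq => //.
  by move=> A _ mA; rewrite -Radon_Nikodym_SigmaFinite.f_integral.
Qed.

(** The substitution is x = m + s sqrt(2) y; the map [F] in the proof is its inverse. *)
Lemma integral_normal_pdf_subst (m s : R) (f : R -> R) : 0 < s ->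
  continuous f -> (forall x, 0 <= f x) ->
  (\int[mu]_x ((f x)%:E * (normal_pdf m s x)%:E) =
   ((Num.sqrt pi)^-1)%:E *
   \int[mu]_y (f (m + s * Num.sqrt 2 * y) * g y)%:E)%E.
Proof.
move=> s0 cf f0.
pose c : R := s * Num.sqrt 2.
have c0 : 0 < c by rewrite mulr_gt0// sqrtr_gt0.
have sp0 : 0 < Num.sqrt (pi : R) by rewrite sqrtr_gt0 pi_gt0.
pose F (x : R^o) := (x - m) / c.
have F'E : (F^`())%classic = cst c^-1.
  apply/funext => x; rewrite /F derive1E deriveM// deriveD// derive_cst scaler0.
  by rewrite add0r derive_id derive_cst addr0 scaler1.
pose G (y : R) := f (m + c * y) * g y.
have cG : continuous G.
  apply: continuous_mul_gauss => y.
  apply: (@continuous_comp _ _ _ (fun y : R => m + c * y) f); last exact: cf.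
  by apply: cvgD; [exact: cvg_cst|apply: cvgM; [exact: cvg_cst|exact: cvg_id]].
have G0 y : 0 <= G y by rewrite mulr_ge0 ?gauss_fun_ge0.
rewrite (_ : (\int[mu]_y (f (m + s * Num.sqrt 2 * y) * g y)%:E)%E =
  (\int[mu]_y (G y)%:E)%E)//.
rewrite (@increasing_ge0_integration_by_substitutionT _ F G)//; first last.
- apply/gt0_cvgMly; last exact: cvg_addrr.
  by rewrite invr_gt0.
- apply/gt0_cvgMlNy; last exact: cvg_addrr_Ny.
  by rewrite invr_gt0.
- by rewrite F'E; exact: is_cvg_cst.
- by rewrite F'E; exact: is_cvg_cst.
- by rewrite F'E => ?; exact: cvg_cst.
- by move=> x y xy; rewrite /F ltr_pM2r ?invr_gt0// ltrD2r.
rewrite -ge0_integralZl ?lee_fin ?invr_ge0 ?sqrtr_ge0//; last 2 first.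
- apply/measurable_EFinP; rewrite F'E; apply: measurable_funM => //.
  apply: measurableT_comp => //; first exact: continuous_measurable_fun cG.
  by apply: measurable_funM => //; exact: measurable_funB.
- move=> x _; rewrite lee_fin; apply: mulr_ge0; first exact: G0.
  by rewrite F'E invr_ge0 ltW.
apply: eq_integral => x _; rewrite F'E -!EFinM; congr _%:E.
have GF : G (F x) = f x * g (F x).
  by rewrite /G /F; congr (f _ * _); rewrite mulrC divfK ?gt_eqF//; ring.
rewrite [RHS](_ : _ = (Num.sqrt pi)^-1 * (G (F x) * c^-1))// GF.
rewrite normal_pdfE ?gt_eqF// /normal_fun /normal_peak /gauss_fun /F.
have -> : - (x - m) ^+ 2 / (s ^+ 2 *+ 2) = - ((x - m) / c) ^+ 2.
  by rewrite /c !exprMn exprVn exprMn sqr_sqrtr// mulNr -mulr_natr.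
rewrite -(mulr_natr (_ * _)) sqrtrM ?mulr_ge0 ?sqr_ge0 ?pi_ge0//.
rewrite sqrtrM ?sqr_ge0// sqrtr_sqr gtr0_norm// /c.
by rewrite !invfM; ring.
all: exact: ltW.
Qed.

(** The formula is chosen to cover s = 0 as well: there the integrand is f(m) g(y), and the Gaussian
    integral sqrt(pi) cancels the factor in front. Later proofs need no case distinction on the
    variance. *)
Lemma ge0_expectation_normal_law (m s : R) (X : {RV P >-> R}) (f : R -> R) :
  0 <= s -> has_normal_law m s X -> continuous f -> (forall x, 0 <= f x) ->
  (\int[P]_w (f (X w))%:E =
   ((Num.sqrt pi)^-1)%:E *
   \int[mu]_y (f (m + s * Num.sqrt 2 * y) * g y)%:E)%E.
Proof.
move=> s0 nX cf f0.
have mf := continuous_measurable_fun cf.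
have mfE : measurable_fun setT (EFin \o f) by exact/measurable_EFinP.
have f0E (x : R) : (0 <= (f x)%:E)%E by rewrite lee_fin.
have sp0 : 0 < Num.sqrt (pi : R) by rewrite sqrtr_gt0 pi_gt0.
have [s00|sN0] := eqVneq s 0.
  have -> : (\int[P]_w (f (X w))%:E)%E = (\int[distribution P X]_x (f x)%:E)%E.
    by rewrite ge0_integral_distribution.
  rewrite (eq_measure_integral (\d_ m : {measure set R -> \bar R})%E); last first.
    by move=> A mA _; have := nX _ mA; rewrite /normal_law s00 eqxx.
  rewrite integral_dirac// diracT mul1e.
  rewrite (_ : (\int[mu]_y _)%E = (\int[mu]_y ((f m)%:E * (g y)%:E))%E); last first.
    by apply: eq_integral => y _; rewrite -EFinM s00 mul0r mul0r addr0.
  rewrite integralZl//; last exact: integrableT_gauss.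
  rewrite integralT_gauss -!EFinM; congr _%:E.
  by rewrite mulrCA mulVf ?gt_eqF// mulr1.
(* X with values in the copy of R over which lebesgue_measure is defined *)
pose Y : W -> measurableTypeR R := X.
have mY : measurable_fun setT Y by move=> _ A mA; exact: (@measurable_funPT _ _ _ _ X).
transitivity (\int[pushforward P Y]_x (f x)%:E)%E.
  by rewrite ge0_integral_pushforward.
transitivity (\int[normal_prob m s]_x (f x)%:E)%E.
  apply: eq_measure_integral => A mA _; have := nX _ mA.
  by rewrite /normal_law (negbTE sN0).
rewrite ge0_integral_normal_prob// integral_normal_pdf_subst//.
by rewrite lt_def sN0.
Qed.

End NormalLawIntegral.

(** * Square integrability, mean and second moment of normal variables *)

Section NormalLawMoments.
Context {R : realType} {d : measure_display} {W : measurableType d}.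
Variable P : probability W R.
Local Notation mu := (@lebesgue_measure R).
Local Notation g := (@gauss_fun R).

Lemma Lfun2P (f : W -> R) : measurable_fun setT f ->
  (\int[P]_w (f w ^+ 2)%:E < +oo)%E -> f \in Lfun P 2%:E.
Proof.
move=> mf f2; rewrite inE; apply/andP; split; rewrite inE//=.
rewrite /finite_norm unlock /Lnorm poweR_lty//.
apply: le_lt_trans f2; rewrite le_eqVlt; apply/orP; left; apply/eqP.
by apply: eq_integral => w _ /=; rewrite powR_mulrn// real_normK ?num_real.
Qed.

Lemma Lfun21 (f : W -> R) : f \in Lfun P 2%:E -> f \in Lfun P 1.
Proof. by apply: Lfun_subset12; rewrite fin_num_measure. Qed.

Lemma Lfun2D (f h : W -> R) : f \in Lfun P 2%:E -> h \in Lfun P 2%:E ->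
  f + h \in Lfun P 2%:E.
Proof. by move=> f2 h2; apply: rpredD => //; exact: lee1n. Qed.

(** Centred at the parameter m, not at the mean, which is still unknown here: the integrand is
    nonnegative, so the transfer formula applies at once, and the result supplies the integrability
    that the mean requires. *)
Lemma normal_law_second_moment (m s : R) (X : {RV P >-> R}) :
  0 <= s -> has_normal_law m s X ->
  'E_P[(fun w => (X w - m) ^+ 2)%R]%E = (s ^+ 2)%:E.
Proof.
move=> s0 nX.
have sp0 : 0 < Num.sqrt (pi : R) by rewrite sqrtr_gt0 pi_gt0.
rewrite unlock (@ge0_expectation_normal_law _ _ _ P m s X (fun x => (x - m) ^+ 2))//.
- rewrite (_ : (\int[mu]_y _)%E =
    (\int[mu]_y ((s ^+ 2 * 2)%:E * (y ^+ 2 * g y)%:E))%E); last first.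
    apply: eq_integral => y _; rewrite -EFinM; congr _%:E.
    rewrite addrAC subrr add0r !exprMn sqr_sqrtr//; ring.
  rewrite ge0_integralZl//; last 3 first.
  + apply/measurable_EFinP; apply: continuous_measurable_fun.
    by apply: continuous_mul_gauss; exact: exprn_continuous.
  + by move=> x _; rewrite lee_fin mulr_ge0 ?sqr_ge0 ?gauss_fun_ge0.
  + by rewrite lee_fin mulr_ge0 ?sqr_ge0.
  rewrite ge0_symfun_integralT//.
  + rewrite -set_itvcy integral0y_sqr_gauss -!EFinM; congr _%:E.
    by field; rewrite gt_eqF.
  + by move=> x; rewrite mulr_ge0 ?sqr_ge0 ?gauss_fun_ge0.
  + by apply: continuous_mul_gauss; exact: exprn_continuous.
  + by move=> x /=; rewrite /gauss_fun !sqrrN.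
- move=> x; apply: (@continuous_comp _ _ _ (fun x => x - m) (fun x => x ^+ 2)).
    by apply: cvgB; [exact: cvg_id|exact: cvg_cst].
  exact: exprn_continuous.
- by move=> x; rewrite sqr_ge0.
Qed.

Lemma normal_law_Lfun2 (m s : R) (X : {RV P >-> R}) :
  0 <= s -> has_normal_law m s X -> (X : W -> R) \in Lfun P 2%:E.
Proof.
move=> s0 nX.
have Xm : (fun w => X w - m) \in Lfun P 2%:E.
  apply: Lfun2P; first exact: measurable_funB.
  by have := normal_law_second_moment s0 nX; rewrite unlock => ->; rewrite ltry.
rewrite (_ : (X : W -> R) = (fun w => X w - m) + cst m); last first.
  by apply/funext => w; rewrite !fctE subrK.
by apply: Lfun2D => //; exact: Lfun_cst.
Qed.

(** The transfer formula is restricted to nonnegative integrands, so X - m is reached through the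
    two nonnegative functions |X - m| and |X - m| + (X - m). Their expectations are equal and
    finite, which forces the expectation of X - m to vanish. *)
Lemma normal_law_mean (m s : R) (X : {RV P >-> R}) :
  0 <= s -> has_normal_law m s X -> 'E_P[X]%E = m%:E.
Proof.
move=> s0 nX.
have X2 := normal_law_Lfun2 s0 nX.
have X1 := Lfun21 X2.
have Xm1 : (X \- cst m : W -> R) \in Lfun P 1.
  by rewrite rpredB//; exact: Lfun_cst.
have aXm1 : Num.norm \o (X \- cst m : W -> R) \in Lfun P 1 by exact: Lfun_norm.
have c0 : 0 <= s * Num.sqrt 2 by rewrite mulr_ge0 ?sqrtr_ge0.
have cB : continuous (fun x : R => x - m).
  by move=> x; apply: cvgB; [exact: cvg_id|exact: cvg_cst].
have cn : continuous (fun x : R => `|x - m|).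
  by move=> x; apply: cvg_norm; exact: cB.
have gp x : 0 <= `|x - m| + (x - m) by have := lerNnormlW (lexx `|x - m|); lra.
have cp : continuous (fun x : R => `|x - m| + (x - m)).
  by move=> x; apply: cvgD; [exact: cn|exact: cB].
have cng : continuous (fun x => `|x| * g x).
  by apply: continuous_mul_gauss => x; apply: cvg_norm; exact: cvg_id.
(* The integrands |y| g y and (|y| + y) g y have the same integral, since the
   first is even and the second vanishes for y < 0. *)
have sym : (\int[mu]_y (`|y| * g y)%:E = \int[mu]_y ((`|y| + y) * g y)%:E)%E.
  rewrite ge0_symfun_integralT//; last 2 first.
    by move=> x; rewrite mulr_ge0 ?gauss_fun_ge0.
    by move=> x /=; rewrite /gauss_fun normrN sqrrN.
  rewrite -set_itvcy -ge0_integralZl//; last 2 first.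
    by apply/measurable_EFinP; apply: measurable_funTS; exact: continuous_measurable_fun.
    by move=> x _; rewrite lee_fin mulr_ge0 ?gauss_fun_ge0.
  rewrite integral_mkcond; apply: eq_integral => y _.
  rewrite patchE; case: ifPn => [|].
    rewrite inE/= in_itv/= andbT => y0.
    by rewrite -EFinM ger0_norm//; congr _%:E; ring.
  rewrite notin_setE/= in_itv/= andbT => /negP; rewrite -ltNge => y0.
  by rewrite ltr0_norm// addNr mul0r.
have same : 'E_P[(fun w => `|X w - m| + (X w - m))%R]%E = 'E_P[(Num.norm \o (X \- cst m))%R]%E.
  rewrite unlock (ge0_expectation_normal_law s0 nX cp gp).
  rewrite (ge0_expectation_normal_law s0 nX cn) => [|x]; last exact: normr_ge0.
  congr (_ * _)%E; set c := s * _ in c0 *.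
  transitivity (c%:E * \int[mu]_y ((`|y| + y) * g y)%:E)%E.
    rewrite -ge0_integralZl//; last 2 first.
    - apply/measurable_EFinP; apply: continuous_measurable_fun.
      apply: continuous_mul_gauss => x.
      by apply: cvgD; [apply: cvg_norm|]; exact: cvg_id.
    - move=> x _; rewrite lee_fin mulr_ge0 ?gauss_fun_ge0//.
      by have := lerNnormlW (lexx `|x|); lra.
    apply: eq_integral => y _; rewrite -EFinM; congr _%:E.
    by rewrite addrAC subrr add0r normrM ger0_norm//; ring.
  rewrite -sym -ge0_integralZl//; last 2 first.
  - by apply/measurable_EFinP; exact: continuous_measurable_fun.
  - by move=> x _; rewrite lee_fin mulr_ge0 ?gauss_fun_ge0.
  apply: eq_integral => y _; rewrite -EFinM; congr _%:E.
  by rewrite addrAC subrr add0r normrM ger0_norm//; ring.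
move: same; rewrite (_ : (fun w => _) =
  ((Num.norm \o (X \- cst m)) \+ (X \- cst m))%R)//.
rewrite expectationD// expectationB//; last exact: Lfun_cst.
rewrite expectation_cst.
have := expectation_fin_num aXm1; case: ('E_P[(Num.norm \o (X \- cst m))%R])%E => // a _.
have := expectation_fin_num X1; case: ('E_P[X])%E => // b _.
by rewrite -EFinB -EFinD => -[] ab; congr _%:E; lra.
Qed.

End NormalLawMoments.

(** * Sums of independent normal variables *)

Section Uncorrelated.
Context {R : realType} {d : measure_display} {W : measurableType d}.
Variable P : probability W R.

Definition independent2 (X Y : W -> R) : Prop :=
  forall A B, measurable A -> measurable B ->
  P (X @^-1` A `&` Y @^-1` B) = (P (X @^-1` A) * P (Y @^-1` B))%E.

Lemma Lfun2Z (a : R) (f : W -> R) : f \in Lfun P 2%:E ->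
  (fun w => a * f w) \in Lfun P 2%:E.
Proof.
move=> f2; rewrite (_ : (fun w => _) = a \o* f).
  by apply: Lfun_scale => //; exact: ler1n.
by apply/funext => w /=; rewrite mulrC.
Qed.

Lemma Lfun2_sum (I : Type) (r : seq I) (F : I -> W -> R) :
  (forall i, F i \in Lfun P 2%:E) ->
  (fun w => \sum_(i <- r) F i w) \in Lfun P 2%:E.
Proof.
move=> F2; elim: r => [|i r IH].
  rewrite (_ : (fun w => _) = cst 0); first exact: Lfun_cst.
  by apply/funext => w; rewrite big_nil.
rewrite (_ : (fun w => _) = F i + (fun w => \sum_(i <- r) F i w)).
  exact: Lfun2D.
by apply/funext => w; rewrite big_cons.
Qed.

Lemma expectation_bigsum (I : eqType) (r : seq I) (F : I -> W -> R) :
  (forall i, F i \in Lfun P 1) ->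
  ('E_P[(fun w => \sum_(i <- r) F i w)%R] = \sum_(i <- r) 'E_P[F i])%E.
Proof.
move=> F1; rewrite (_ : (fun w => _) = \sum_(f <- [seq F i | i <- r]) f)%R.
  by rewrite expectation_sum ?big_map// => f /mapP[i _ ->]; exact: F1.
by apply/funext => w; rewrite big_map fct_sumE.
Qed.

(** The law of the pair agrees with the product of the two laws on rectangles, hence everywhere by
    uniqueness of the product measure; Fubini then splits the integral of the product. *)
Lemma expectation_mul_independent2 (X Y : {RV P >-> R}) :
  (X : W -> R) \in Lfun P 2%:E -> (Y : W -> R) \in Lfun P 2%:E ->
  independent2 X Y -> 'E_P[X * Y]%E = ('E_P[X] * 'E_P[Y])%E.
Proof.
move=> X2 Y2 XY.
pose V (w : W) : R * R := (X w, Y w).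
have mV : measurable_fun setT V by exact: measurable_fun_pair.
pose D := pushforward P V.
have DE A : measurable A -> (distribution P X \x distribution P Y)%E A = D A.
  apply: product_measure_unique => B C mB mC.
  by rewrite -XY.
pose f (z : R * R) : \bar R := (z.1 * z.2)%:E.
have mf : measurable_fun setT f.
  by apply/measurable_EFinP; apply: measurable_funM; [exact: measurable_fst|exact: measurable_snd].
have iXY : P.-integrable setT (EFin \o (X \* Y)).
  by apply/Lfun1_integrable; exact: Lfun2_mul_Lfun1.
have iX : P.-integrable setT (EFin \o X) by apply/Lfun1_integrable; exact: Lfun21.
have iY : P.-integrable setT (EFin \o Y) by apply/Lfun1_integrable; exact: Lfun21.
have ifD : (distribution P X \x distribution P Y)%E.-integrable setT f.
  apply/integrableP; split => //.
  rewrite (eq_measure_integral D) => [|A mA _]; last exact: DE.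
  rewrite ge0_integral_pushforward//; last exact: measurableT_comp.
  by have /integrableP[] := iXY.
transitivity (\int[D]_z f z)%E.
  by rewrite unlock [RHS]integral_pushforward.
transitivity (\int[distribution P X \x distribution P Y]_z f z)%E.
  by apply: eq_measure_integral => A mA _; exact/esym/DE.
rewrite -integral12_prod_meas1//.
have EY : (\int[distribution P Y]_y y%:E)%E = 'E_P[Y]%E.
  by rewrite unlock integral_distribution.
have EX : (\int[distribution P X]_y y%:E)%E = 'E_P[X]%E.
  by rewrite unlock integral_distribution.
have iDX : (distribution P X).-integrable setT (EFin : R -> \bar R).
  apply/integrableP; split; first exact/measurable_EFinP.
  rewrite ge0_integral_distribution//; last by apply: measurableT_comp => //; exact/measurable_EFinP.
  by have /integrableP[] := iX.
have iDY : (distribution P Y).-integrable setT (EFin : R -> \bar R).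
  apply/integrableP; split; first exact/measurable_EFinP.
  rewrite ge0_integral_distribution//; last by apply: measurableT_comp => //; exact/measurable_EFinP.
  by have /integrableP[] := iY.
rewrite /fubini_F /f /=.
transitivity (\int[distribution P X]_x (x%:E * 'E_P[Y])%E)%E.
  apply: eq_integral => x _; rewrite -EY -integralZl//.
have := expectation_fin_num (Lfun21 Y2); case: ('E_P[Y]%E) => // b _.
by rewrite integralZr// EX.
Qed.

(** The hypothesis on the mixed moments says that the covariance matrix is diagonal with entries
    [v], so the off-diagonal terms of the square rebuild only the square of the mean. *)
Lemma expectation_uncorrelated_sum (I : finType) (F : I -> W -> R)
    (a mu v : I -> R) :
  (forall i, F i \in Lfun P 2%:E) ->
  (forall i, 'E_P[F i]%E = (mu i)%:E) ->
  (forall i j, 'E_P[F i * F j]%E = (mu i * mu j + (i == j)%:R * v i)%:E) ->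
  let S w := \sum_i a i * F i w in
  [/\ S \in Lfun P 2%:E, 'E_P[S]%E = (\sum_i a i * mu i)%:E,
      'E_P[(fun w => S w ^+ 2)%R]%E =
        ((\sum_i a i * mu i) ^+ 2 + \sum_i a i ^+ 2 * v i)%:E &
      'V_P[S]%E = (\sum_i a i ^+ 2 * v i)%:E].
Proof.
move=> F2 EF CF S.
have aF2 i : (fun w => a i * F i w) \in Lfun P 2%:E by exact: Lfun2Z.
have S2 : S \in Lfun P 2%:E by exact: Lfun2_sum.
have ES : 'E_P[S]%E = (\sum_i a i * mu i)%:E.
  rewrite expectation_bigsum => [|i]; last exact: Lfun21.
  rewrite -sumEFin; apply: eq_bigr => i _.
  rewrite (_ : (fun w => _) = a i \o* F i)%R; last first.
    by apply/funext => w /=; rewrite mulrC.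
  by rewrite expectationZl ?EF//; exact: Lfun21.
have ESS : 'E_P[(fun w => S w ^+ 2)%R]%E =
    ((\sum_i a i * mu i) ^+ 2 + \sum_i a i ^+ 2 * v i)%:E.
  have FF i j : (F i * F j) \in Lfun P 1 by exact: Lfun2_mul_Lfun1.
  have aFF i j : (fun w => a i * a j * (F i * F j) w) \in Lfun P 1.
    rewrite (_ : (fun w => _) = (a i * a j) \o* (F i * F j)).
      exact: Lfun_scale.
    by apply/funext => w /=; rewrite mulrC.
  rewrite (_ : (fun w => _) = (fun w => \sum_(p : I * I) a p.1 * a p.2 * (F p.1 * F p.2) w))%R; last first.
    apply/funext => w; rewrite expr2 /S big_distrlr/= pair_bigA/=.
    by apply: eq_bigr => p _; rewrite !fctE; ring.
  rewrite expectation_bigsum => [|p]; last exact: aFF.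
  transitivity ((\sum_(p : I * I) (a p.1 * a p.2 * (mu p.1 * mu p.2 + (p.1 == p.2)%:R * v p.1)))%:E).
    rewrite -sumEFin; apply: eq_bigr => p _.
    rewrite (_ : (fun w => _) = (a p.1 * a p.2) \o* (F p.1 * F p.2))%R; last first.
      by apply/funext => w /=; rewrite mulrC.
    by rewrite expectationZl// CF.
  congr _%:E; rewrite -(pair_bigA _ (fun i j => a i * a j * (mu i * mu j + (i == j)%:R * v i)))/=.
  rewrite expr2 big_distrlr/= -big_split/=; apply: eq_bigr => i _.
  rewrite (bigD1 i)//= [in RHS](bigD1 i)//= eqxx.
  rewrite [RHS]addrAC; congr (_ + _); first by rewrite /=; ring.
  by apply: eq_bigr => j ji; rewrite eq_sym (negbTE ji) /=; ring.
split => //.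
rewrite varianceE// ES [X in ('E_P[X])%E](_ : _ = (fun w => S w ^+ 2)%R) ?ESS; last first.
  by apply/funext => w; rewrite exprfctE.
by rewrite -EFin_expe -EFinB addrAC subrr add0r.
Qed.

End Uncorrelated.

(** * Moments of linear combinations of an initial point and the noises *)

Section SampleMoments.
Context {R : realType} {d : measure_display} {W : measurableType d}.
Variable P : probability W R.

Lemma independent2C (X Y : W -> R) : independent2 P X Y -> independent2 P Y X.
Proof. by move=> XY A B mA mB; rewrite setIC XY// muleC. Qed.

Lemma mutually_independent2 (I : finType) (X : I -> W -> R) (i j : I) :
  mutually_independent P X -> i != j -> independent2 P (X i) (X j).
Proof.
move=> iX ij A B mA mB.
pose C k := if k == i then A else if k == j then B else setT.
have ji : (j == i) = false by rewrite eq_sym (negbTE ij).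
have := iX C; rewrite (_ : \bigcap_(k in _) _ = X i @^-1` A `&` X j @^-1` B).
  move=> ->; last by rewrite /C => k; case: ifP => // _; case: ifP.
  rewrite (bigD1 i)//= (bigD1 j) ?ji//=.
  rewrite big1 => [|k /andP[ki kj]].
    by rewrite mule1 /C eqxx ji eqxx.
  by rewrite /C (negbTE ki) (negbTE kj) preimage_setT probability_setT.
apply/seteqP; split => w /=.
  by move=> h; split; [have := h i Logic.I|have := h j Logic.I]; rewrite /C /= ?ji eqxx.
by move=> [hi hj] k _; rewrite /C /=; case: eqP => [->//|_]; case: eqP => [->//|].
Qed.

Lemma independent_of_family2 (I : finType) (Y : W -> R) (X : I -> W -> R) (i : I) :
  independent_of_family P Y X -> independent2 P Y (X i).
Proof.
move=> iYX A B mA mB.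
pose C k := if k == i then B else setT.
have := iYX A C mA; rewrite (_ : \bigcap_(k in _) _ = X i @^-1` B).
  by apply => k; rewrite /C; case: ifP.
apply/seteqP; split => w /=; first by move=> /(_ i Logic.I); rewrite /C eqxx.
by move=> hi k _; rewrite /C /=; case: eqP => [->|].
Qed.

Lemma expectation_sqr_normal (m s : R) (X : {RV P >-> R}) :
  0 <= s -> has_normal_law m s X -> 'E_P[X * X]%E = (m ^+ 2 + s ^+ 2)%:E.
Proof.
move=> s0 nX; have X2 := normal_law_Lfun2 s0 nX; have X1 := Lfun21 X2.
have XX1 : (X * X : W -> R) \in Lfun P 1 by exact: Lfun2_mul_Lfun1.
have := normal_law_second_moment s0 nX.
rewrite (_ : (fun w => _) = (X * X \- (2 * m) \o* X) \+ cst (m ^+ 2))%R; last first.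
  by apply/funext => w /=; rewrite !fctE; ring.
have X1' : (2 * m) \o* (X : W -> R) \in Lfun P 1 by exact: Lfun_scale.
rewrite expectationD ?expectationB//; last 2 first.
  by rewrite rpredB.
  exact: Lfun_cst.
rewrite expectation_cst expectationZl// (normal_law_mean s0 nX).
have := expectation_fin_num XX1; case: ('E_P[X * X]%E) => // c _.
by rewrite -EFinM -EFinB -EFinD => -[] h; congr _%:E; lra.
Qed.

Section Moments.
Variables (m s : R) (s0 : 0 <= s) (J : finType) (Z : J -> {RV P >-> R}).
Hypothesis nZ : forall j, has_normal_law m s (Z j).
Hypothesis iZ : forall j k, j != k -> independent2 P (Z j) (Z k).

Lemma expectation_sqr_noise_sum (b : J -> R) :
  'E_P[(fun w => (\sum_j b j * Z j w) ^+ 2)%R]%E =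
  (m ^+ 2 * (\sum_j b j) ^+ 2 + s ^+ 2 * \sum_j b j ^+ 2)%:E.
Proof.
have [|||_ _ -> _] := @expectation_uncorrelated_sum _ _ _ P _ Z b
    (fun=> m) (fun=> s ^+ 2).
- by move=> j; exact: normal_law_Lfun2 (nZ j).
- by move=> j; exact: normal_law_mean (nZ j).
- move=> i j; have [->|ij] := eqVneq i j.
    by rewrite (expectation_sqr_normal s0 (nZ j)) mul1r expr2.
  rewrite mul0r addr0 expectation_mul_independent2; last exact: iZ.
  + by rewrite (normal_law_mean s0 (nZ i)) (normal_law_mean s0 (nZ j)).
  + exact: normal_law_Lfun2 (nZ i).
  + exact: normal_law_Lfun2 (nZ j).
by rewrite -!mulr_suml; congr _%:E; ring.
Qed.

Lemma init_noise_sum_moments (X0 : {RV P >-> R}) (a : R) (b : J -> R) :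
  has_normal_law 0 1 X0 -> (forall j, independent2 P X0 (Z j)) ->
  let S w := a * X0 w + \sum_j b j * Z j w in
  [/\ S \in Lfun P 2%:E, 'E_P[S]%E = (m * \sum_j b j)%:E &
      'V_P[S]%E = (a ^+ 2 + s ^+ 2 * \sum_j b j ^+ 2)%:E].
Proof.
move=> nX0 iX0 S.
have bigo (f : option J -> R) : \sum_o f o = f None + \sum_j f (Some j).
  rewrite (bigD1 None)//=; congr (_ + _).
  rewrite (reindex_omap Some id)/=; last by case.
  by apply: eq_bigl => j; rewrite eqxx.
(* The initial point becomes the extra index [None], with mean 0 and variance 1, next to the noises
   with mean m and variance s^2. *)
pose F o : W -> R := if o is Some j then Z j else X0.
pose c o := if o is Some j then b j else a.
pose mu (o : option J) : R := if o is Some j then m else 0.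
pose v (o : option J) : R := if o is Some j then s ^+ 2 else 1.
have L0 := normal_law_Lfun2 ler01 nX0; have E0 := normal_law_mean ler01 nX0.
have LZ j := normal_law_Lfun2 s0 (nZ j).
have EZ j := normal_law_mean s0 (nZ j).
have SE : S = (fun w => \sum_o c o * F o w).
  by apply/funext => w; rewrite bigo.
have [|||] := @expectation_uncorrelated_sum _ _ _ P _ F c mu v.
- by case.
- by case.
- move=> [i|] [j|] /=.
  + have [->|ij] := eqVneq i j.
      by rewrite eqxx (expectation_sqr_normal s0 (nZ j)) mul1r expr2.
    rewrite [_ == _](negbTE ij) mul0r addr0 expectation_mul_independent2 ?EZ//.
    exact: iZ.
  + rewrite mulr0 mul0r addr0 expectation_mul_independent2 ?EZ ?E0 ?mule0//.
    exact/independent2C.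
  + by rewrite mul0r mul0r addr0 expectation_mul_independent2 ?EZ ?E0 ?mul0e.
  + by rewrite (expectation_sqr_normal ler01 nX0); congr _%:E; ring.
rewrite -SE !bigo /= => -> -> _ ->; split => //; congr _%:E.
  by rewrite mulr0 add0r -mulr_suml mulrC.
by rewrite mulr1 -mulr_suml mulrC.
Qed.

End Moments.
End SampleMoments.

(** * Mixtures *)

Section AverageLaw.
Context {R : realType} {d d' : measure_display} {W : measurableType d}.
Context {W' : measurableType d'}.
Variables (P : probability W R) (Q : probability W' R).

Lemma ge0_integral_average_law (Y : {RV Q >-> R}) (I : finType) (K : pred I)
    (n : nat) (X : I -> W -> R) (f : R -> \bar R) :
  has_average_law P Y K n X -> (forall i, K i -> measurable_fun setT (X i)) ->
  measurable_fun setT f -> (forall x, 0 <= f x)%E ->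
  (\int[Q]_w f (Y w) = (n%:R^-1)%:E * \sum_(i | K i) \int[P]_w f (X i w))%E.
Proof.
move=> lawY mX mf f0.
have mXo (o : 'I_#|K|) : X (enum_val o) \in @mfun _ _ W R.
  by rewrite inE /=; apply: mX; exact: enum_valP.
pose Xm o : {mfun W >-> R} := mfun_Sub (mXo o).
(* [msum] takes a sequence of measures indexed by all naturals: the members of K are enumerated, and
   the sequence is continued by the zero measure. *)
pose m_ (k : nat) : {measure set R -> \bar R} :=
  match insub k with Some o => distribution P (Xm o) | None => mzero end.
have bigK (G : I -> \bar R) :
  (\sum_(i | K i) G i = \sum_(o < #|K|) G (enum_val o))%E.
  by rewrite -big_enum_val; apply: eq_bigl.
have c0 : 0 <= n%:R^-1 :> R by [].
have -> : (\int[Q]_w f (Y w))%E = (\int[distribution Q Y]_x f x)%E.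
  by rewrite ge0_integral_distribution.
rewrite (eq_measure_integral (mscale (NngNum c0) (msum m_ #|K|))); last first.
  move=> A mA _; transitivity (distribution Q Y A) => //; rewrite lawY//.
  rewrite /= /mscale/= /msum; congr (_ * _)%E.
  rewrite bigK; apply: eq_bigr => o _.
  by rewrite /m_ valK.
rewrite ge0_integral_mscale// ge0_integral_measure_sum//.
congr (_ * _)%E; rewrite bigK; apply: eq_bigr => o _.
by rewrite /m_ valK ge0_integral_distribution.
Qed.

Section Moments.
Variables (Y : {RV Q >-> R}) (I : finType) (K : pred I) (n : nat).
Variables (X : I -> W -> R) (mu v : I -> R).
Hypothesis lawY : has_average_law P Y K n X.
Hypothesis X2 : forall i, K i -> X i \in Lfun P 2%:E.
Hypothesis EX : forall i, K i -> 'E_P[X i]%E = (mu i)%:E.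
Hypothesis VX : forall i, K i -> 'V_P[X i]%E = (v i)%:E.

Let mX i : K i -> measurable_fun setT (X i).
Proof. by move=> /X2; rewrite inE => /andP[]; rewrite inE. Qed.

Let EXX i : K i -> 'E_P[(fun w => X i w ^+ 2)%R]%E = (v i + mu i ^+ 2)%:E.
Proof.
move=> Ki; have := VX Ki; rewrite varianceE ?X2// EX//.
rewrite [X in ('E_P[X] - _)%E](_ : _ = (fun w => X i w ^+ 2)%R); last first.
  by apply/funext => w; rewrite exprfctE.
case: ('E_P[_]%E) => // c; rewrite -EFin_expe -EFinB => -[] <-.
by congr _%:E; ring.
Qed.

Lemma ge0_expectation_average_law (f : R -> R) (r : I -> R) :
  measurable_fun setT f -> (forall x, 0 <= f x) ->
  (forall i, K i -> 'E_P[(fun w => f (X i w))]%E = (r i)%:E) ->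
  'E_Q[(fun w => f (Y w))]%E = (n%:R^-1 * \sum_(i | K i) r i)%:E.
Proof.
move=> mf f0 Er; rewrite unlock.
rewrite (@ge0_integral_average_law Y I K n X (EFin \o f))//; last first.
  exact/measurable_EFinP.
rewrite EFinM -sumEFin; congr (_ * _)%E; apply: eq_bigr => i Ki.
by rewrite -Er// unlock.
Qed.

Let EYY : 'E_Q[(fun w => Y w ^+ 2)%R]%E =
  (n%:R^-1 * \sum_(i | K i) (v i + mu i ^+ 2))%:E.
Proof.
apply: (@ge0_expectation_average_law (fun x => x ^+ 2)) => // x.
exact: sqr_ge0.
Qed.

Let Y2 : (Y : W' -> R) \in Lfun Q 2%:E.
Proof.
by apply: Lfun2P => //; have := EYY; rewrite unlock => ->; rewrite ltry.
Qed.

(** Averages of laws, too, transfer only nonnegative integrands: the mean is obtained as the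
    difference between the expectations of |x| + x and |x|. *)
Let EY : 'E_Q[Y]%E = (n%:R^-1 * \sum_(i | K i) mu i)%:E.
Proof.
have Y1 := Lfun21 Y2; have aY1 := Lfun_norm Y1.
have X1 i : K i -> X i \in Lfun P 1 by move=> /X2; exact: Lfun21.
have aX1 i : K i -> Num.norm \o X i \in Lfun P 1 by move=> /X1; exact: Lfun_norm.
pose r i := fine ('E_P[Num.norm \o X i])%E.
have Er i : K i -> ('E_P[Num.norm \o X i] = (r i)%:E)%E.
  by move=> Ki; rewrite fineK// expectation_fin_num ?aX1.
have nY := @ge0_expectation_average_law Num.norm r
  (@normr_measurable R setT) (@normr_ge0 _ _) Er.
have gp (x : R) : 0 <= `|x| + x by have := lerNnormlW (lexx `|x|); lra.
have mp : measurable_fun setT (fun x : R => `|x| + x).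
  by apply: measurable_funD => //; exact: normr_measurable.
have Ep i : K i -> 'E_P[(fun w => `|X i w| + X i w)%R]%E = (r i + mu i)%:E.
  move=> Ki; rewrite (_ : (fun w => _) = (Num.norm \o X i \+ X i))%R//.
  by rewrite expectationD ?aX1 ?X1// Er// EX.
have := ge0_expectation_average_law mp gp Ep.
rewrite (_ : (fun w => _) = (Num.norm \o Y \+ Y))%R//.
rewrite expectationD// nY big_split/= mulrDr EFinD.
by case: ('E_Q[Y])%E => // b; rewrite -!EFinD => -[] /addrI ->.
Qed.

Lemma average_law_moments :
  [/\ (Y : W' -> R) \in Lfun Q 2%:E,
      'E_Q[Y]%E = (n%:R^-1 * \sum_(i | K i) mu i)%:E &
      'V_Q[Y]%E = (n%:R^-1 * (\sum_(i | K i) (v i + mu i ^+ 2)) -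
                   (n%:R^-1 * \sum_(i | K i) mu i) ^+ 2)%:E].
Proof.
split => //; rewrite varianceE// EY.
rewrite [X in ('E_Q[X] - _)%E](_ : _ = (fun w => Y w ^+ 2)%R); last first.
  by apply/funext => w; rewrite exprfctE.
by rewrite EYY -EFin_expe -EFinB.
Qed.

End Moments.

(** Law of total variance: the surplus is the average squared deviation of the component means from
    their own average. If K is empty, the convention that 0 has inverse 0 makes both terms of this
    surplus vanish. *)
Lemma average_law_variance_ge (Y : {RV Q >-> R}) (I : finType) (K : pred I)
    (X : I -> W -> R) (mu v : I -> R) :
  has_average_law P Y K #|K| X ->
  (forall i, K i -> X i \in Lfun P 2%:E) ->
  (forall i, K i -> 'E_P[X i]%E = (mu i)%:E) ->
  (forall i, K i -> 'V_P[X i]%E = (v i)%:E) ->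
  ((#|K|%:R^-1 * \sum_(i | K i) v i)%:E <= 'V_Q[Y])%E.
Proof.
move=> lawY X2 EX VX; have [_ _ ->] := average_law_moments lawY X2 EX VX.
rewrite lee_fin big_split/= mulrDr -addrA lerDl.
set n := #|K|%:R; set S := \sum_(i | K i) mu i.
have [n0|n0] := eqVneq n 0.
  by rewrite n0 invr0 !mul0r expr0n subrr.
have n1 : 0 < n by rewrite lt_def n0 ler0n.
rewrite [leRHS](_ : _ = n^-1 * \sum_(i | K i) (mu i - n^-1 * S) ^+ 2).
  by rewrite mulr_ge0 ?invr_ge0 ?ler0n// sumr_ge0// => i _; exact: sqr_ge0.
rewrite [in RHS](eq_bigr (fun i => mu i ^+ 2 - (2 * (n^-1 * S)) * mu i + (n^-1 * S) ^+ 2)); last first.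
  by move=> i _; ring.
rewrite big_split/= sumrB -mulr_sumr sumr_const -/S -[_ *+ #|K|]mulr_natr -/n.
by field.
Qed.

End AverageLaw.

(** * Trajectories and cost of Model 1 controllers *)

Section LQR.
Context {R : realType}.
Implicit Types (T N : nat) (eps t : R).

(** The denominator of the gain. The gain T / h solves the Riccati equation k' = k^2 with k(T) = T,
    and x^2 / h(t) is the optimal cost to go from (t, x). *)
Definition riccati T t : R := T%:R * (T%:R - t) + 1.

Lemma riccati_ge1 T t : t <= T%:R -> 1 <= riccati T t.
Proof. by move=> tT; rewrite lerDr mulr_ge0// subr_ge0. Qed.

Lemma riccati_gt0 T t : t <= T%:R -> 0 < riccati T t.
Proof. by move=> /riccati_ge1; exact: lt_le_trans. Qed.

Lemma riccati_neq0 T t : t <= T%:R -> riccati T t != 0.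
Proof. by move=> /riccati_gt0 h0; rewrite gt_eqF. Qed.

Lemma riccatiT T : riccati T T%:R = 1.
Proof. by rewrite /riccati subrr mulr0 add0r. Qed.

Lemma riccatiS T (k : nat) : riccati T k.+1%:R = riccati T k%:R - T%:R.
Proof. by rewrite /riccati -natr1; ring. Qed.

(** A single competitor suffices, the constant mean M of the residuals r_i: the loss of b exceeds
    that of M by n (M - b)^2, so optimality of b forces b = M. *)
Lemma least_squares_mean T (I : finType) (K : R -> pred I) (uhat xhat : I -> R -> R)
    (b : R -> R) t :
  least_squares T K uhat xhat b -> t \in `[0, T%:R] -> (0 < #|K t|)%N ->
  b t = #|K t|%:R^-1 * \sum_(i | K t i) (uhat i t + gain T t * xhat i t).
Proof.
move=> ls tT K0; set r := fun i => uhat i t + gain T t * xhat i t.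
set n : R := #|K t|%:R; have n0 : 0 < n by rewrite ltr0n.
have natmulE (x : R) : x *+ #|K t| = n * x by rewrite mulr_natl.
set M := n^-1 * _.
have lossE b' : square_loss (K t) uhat xhat (model1 T b') t =
    \sum_(i | K t i) (r i - b' t) ^+ 2.
  apply: eq_bigr => i _; rewrite real_normK ?num_real//; congr (_ ^+ 2).
  by rewrite /model1 /r; ring.
have := ls t tT (fun=> M); rewrite !lossE.
have -> : \sum_(i | K t i) (r i - b t) ^+ 2 =
    \sum_(i | K t i) (r i - M) ^+ 2 + n * (M - b t) ^+ 2.
  rewrite (eq_bigr (fun i => (r i - M) ^+ 2 + 2 * (M - b t) * (r i - M) + (M - b t) ^+ 2)).
    rewrite !big_split/= -mulr_sumr sumrB !sumr_const.
    have -> : \sum_(i | K t i) r i = n * M by rewrite mulrA divff ?mul1r// gt_eqF.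
    by rewrite !natmulE subrr mulr0 addr0.
  by move=> i _; move: (r i) (b t) M => x y z; ring.
rewrite gerDl pmulr_rle0// => h; have /eqP : (M - b t) ^+ 2 == 0.
  by rewrite eq_le h sqr_ge0.
by move/eqP; rewrite sqrf_eq0 subr_eq0 => /eqP ->.
Qed.

(** The optimal part of the path satisfies u + gain x = 0 and drops out. What remains is eps z (1 +
    T (t - t0) / h(t)), and h(t) + T (t - t0) = h(t0). *)
Lemma solver_residual T eps (t0 x0 z t : R) : t0 <= T%:R -> t <= T%:R ->
  solver_u T eps t0 x0 z t + gain T t * solver_x T eps t0 x0 z t =
  eps * riccati T t0 * z / riccati T t.
Proof.
move=> /riccati_neq0 h0 /riccati_neq0 ht.
rewrite /solver_u /solver_x /gain -!/(riccati T _).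
have -> : riccati T t0 = riccati T t + T%:R * (t - t0) by rewrite /riccati; ring.
field; rewrite ht /=.
by rewrite (_ : _ + _ = riccati T t0)//; rewrite /riccati; ring.
Qed.

Lemma stageE T t (i : nat) : (i < T)%N -> i%:R <= t < i.+1%:R -> stage T t = i.
Proof.
move=> iT it; rewrite /stage (_ : Num.truncn t = i).
  by apply/minn_idPl; rewrite -ltnS prednK// (leq_ltn_trans _ iT).
apply/eqP; rewrite truncn_eq//.
by case/andP: it => it _; exact: le_trans it.
Qed.

Lemma stageT T : (0 < T)%N -> stage T (T%:R : R) = T.-1.
Proof. by move=> T0; rewrite /stage natrK; apply/minn_idPr; rewrite leq_pred. Qed.

Lemma stage_bounds T t : (0 < T)%N -> 0 <= t <= T%:R ->
  [/\ (stage T t < T)%N, (stage T t)%:R <= t & t <= (stage T t).+1%:R].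
Proof.
move=> T0 /andP[t0 tT].
have [<-|tNT] := eqVneq T%:R t; first by rewrite stageT// prednK// ler_nat leq_pred.
have {tNT}tT : t < T%:R by rewrite lt_neqAle eq_sym tNT.
have /andP[t1 t2] := truncn_itv t0.
have iT : (Num.truncn t < T)%N by rewrite -(@ltr_nat R) (le_lt_trans t1).
by rewrite (@stageE _ _ (Num.truncn t))// ?t1//; split => //; exact: ltW.
Qed.

(** The solutions are only piecewise C^1, so the mean value theorem cannot be used on the whole
    interval. Induction on the exceptional points cuts the interval at each of them; continuity
    joins the pieces. *)
Lemma eq_endpoints_off_finite (s : seq R) (f : R -> R) (a b : R) : a <= b ->
  {within `[a, b], continuous f} ->
  (forall t, t \in `]a, b[ -> t \notin s -> is_derive t (1 : R) f 0) ->
  f a = f b.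
Proof.
elim: s a b => [|p s IH] a b ab cf df.
  move: ab; rewrite le_eqVlt => /predU1P[->//|ab].
  have [|c _] := @MVT R f (cst 0) a b ab _ cf.
    by move=> x xab; apply: df.
  by rewrite mul0r => /eqP; rewrite subr_eq0 => /eqP.
have [pab|pab] := boolP (p \in `]a, b[); last first.
  apply: IH => // t tab ts; apply: df => //; rewrite inE negb_or ts andbT.
  by apply: contra pab => /eqP <-.
move: (pab); rewrite in_itv/= => /andP[ap pb].
have cl : {within `[a, p], continuous f}.
  by apply: continuous_subspaceW cf; apply: subset_itvl; rewrite bnd_simp ltW.
have cr : {within `[p, b], continuous f}.
  by apply: continuous_subspaceW cf; apply: subset_itvr; rewrite bnd_simp ltW.
have dl t : t \in `]a, p[ -> t \notin s -> is_derive t (1 : R) f 0.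
  rewrite in_itv/= => /andP[at_ tp] ts; apply: df.
    by rewrite in_itv/= at_ (lt_trans tp).
  by rewrite inE negb_or ts andbT lt_eqF.
have dr t : t \in `]p, b[ -> t \notin s -> is_derive t (1 : R) f 0.
  rewrite in_itv/= => /andP[pt tb] ts; apply: df.
    by rewrite in_itv/= tb (lt_trans ap).
  by rewrite inE negb_or ts andbT gt_eqF.
exact: etrans (IH a p (ltW ap) cl dl) (IH p b (ltW pb) cr dr).
Qed.

End LQR.

(** * Explicit trajectories of controllers of the form c_k / h on each stage *)

Section Flow.
Context {R : realType}.
Implicit Types (T : nat) (a t : R) (c : nat -> R).
Local Notation h := (@riccati R).

Lemma is_derive_riccati T t : is_derive t (1 : R) (@riccati R T) (- T%:R).
Proof.
rewrite /riccati; apply: is_derive_eq.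
by rewrite /GRing.scale/=; ring.
Qed.

Lemma continuous_riccati T : continuous (@riccati R T).
Proof.
move=> t; apply: differentiable_continuous; apply/derivable1_diffP.
by have [] := is_derive_riccati T t.
Qed.

(* On a stage x / h - (c / T) / h has derivative 0, where h = riccati T. *)
Lemma model1_stage T a (b : R -> R) (x0 c : R) (x : R -> R) (s t : R) :
  (0 < T)%N -> a <= T%:R -> ode_solution a (model1 T b) x0 x ->
  0 <= s <= t -> t <= a ->
  (forall r, s < r < t -> b r = c / h T r) ->
  x t / h T t = x s / h T s + c * (t - s) / (h T s * h T t).
Proof.
move=> T0 aT [_ cx [l [dx _ _]]] /andP[s0 st] ta bE.
have hN0 r : r <= t -> h T r != 0.
  by move=> rt; rewrite riccati_neq0// (le_trans rt)// (le_trans ta).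
have T0' : T%:R != 0 :> R by rewrite pnatr_eq0 -lt0n.
pose g r := (x r - c / T%:R) / h T r.
have gst : g s = g t.
  apply: (@eq_endpoints_off_finite _ l g s t st).
    have cx' : {within `[s, t], continuous x}.
      by apply: continuous_subspaceW cx; apply: subset_itv; rewrite bnd_simp.
    have chV : {within `[s, t], continuous (fun r => (h T r)^-1)}.
      apply: continuous_in_subspaceT => r; rewrite inE/= in_itv/= => /andP[_ rt].
      by apply: cvgV; [exact: hN0|exact: continuous_riccati].
    move=> r; apply: cvgM.
      by apply: cvgB; [exact: cx'|exact: cvg_cst].
    exact: chV.
  move=> r rst rl; move: (rst); rewrite in_itv/= => /andP[sr rt].
  have [] := dx r.
  - by rewrite in_itv/= (le_lt_trans s0 sr) (lt_le_trans rt).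
  - exact: rl.
  move=> dxr _.
  have dh := is_derive_riccati T r.
  have hr := hN0 r (ltW rt).
  have dhV := is_deriveV hr dh.
  have d1 : is_derive r (1 : R) (fun r => x r - c / T%:R) (model1 T b r (x r)).
    by apply: is_derive_eq; rewrite subr0.
  have := is_deriveM d1 dhV; rewrite /g.
  move=> dM; apply: is_derive_eq.
  rewrite /GRing.scale /= /model1 bE ?sr// /gain -/(h T r).
  move: hr; move: (h T r) (x r) => k z k0.
  by field; rewrite k0.
have [hs ht] : h T s != 0 /\ h T t != 0 by rewrite !hN0.
have htE : h T t = h T s - T%:R * (t - s) by rewrite /riccati; ring.
move: gst; rewrite /g !mulrBl => /(congr1 (fun z => z + c / T%:R / h T t)).
rewrite subrK => <-; rewrite -addrA; congr (_ + _).
apply: (mulIf hs); apply: (mulIf ht); apply: (mulIf T0').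
move: hs ht; move: htE; move: (h T s) (h T t) => p q pq p0 q0.
rewrite pq in q0 *.
by field; rewrite q0 p0.
Qed.

(** The value of x / h at time n. Stage k adds (c_k / T) (1 / h(k + 1) - 1 / h(k)), which is the
    summand because h(k) - h(k + 1) = T. *)
Definition model1_state T c (x0 : R) (n : nat) : R :=
  x0 / h T 0 + \sum_(k < n) c k / (h T k%:R * h T k.+1%:R).

Lemma model1_state_grid T a (b : R -> R) c (x0 : R) (x : R -> R) (n : nat) :
  (0 < T)%N -> a <= T%:R -> n%:R <= a -> ode_solution a (model1 T b) x0 x ->
  (forall k r, (k < n)%N -> k%:R < r < k.+1%:R -> b r = c k / h T r) ->
  x n%:R = h T n%:R * model1_state T c x0 n.
Proof.
move=> T0 aT na ode bE.
have hN0 (k : nat) : k%:R <= a -> h T k%:R != 0.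
  by move=> ka; rewrite riccati_neq0// (le_trans ka).
suff : x n%:R / h T n%:R = model1_state T c x0 n.
  by move=> <-; rewrite mulrC divfK//; exact: hN0.
elim: n na bE => [|n IH] na bE.
  by rewrite /model1_state big_ord0 addr0 (ode_init ode).
have na' : n%:R <= a by rewrite (le_trans _ na)// ler_nat.
rewrite (@model1_stage T a b x0 (c n) x n%:R n.+1%:R T0 aT ode)//.
- rewrite IH//; last by move=> k r kn; apply: bE; rewrite ltnS ltnW.
  rewrite /model1_state big_ord_recr/= addrA; congr (_ + _ / _).
  by rewrite -natr1; ring.
- by rewrite ler0n ler_nat leqnSn.
- by move=> r nr; apply: bE.
Qed.

Lemma model1_state_flow T a (b : R -> R) c (x0 : R) (x : R -> R) (n : nat) t :
  (0 < T)%N -> a <= T%:R -> n%:R <= t <= n.+1%:R -> t <= a ->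
  ode_solution a (model1 T b) x0 x ->
  (forall k r, (k <= n)%N -> k%:R <= r < k.+1%:R -> r < a -> b r = c k / h T r) ->
  x t = h T t * model1_state T c x0 n + c n * (t - n%:R) / h T n%:R.
Proof.
move=> T0 aT /andP[nt tn] ta ode bE.
have na : n%:R <= a by exact: le_trans ta.
have ht : h T t != 0 by rewrite riccati_neq0// (le_trans ta).
have hn : h T n%:R != 0 by rewrite riccati_neq0// (le_trans na).
have xn : x n%:R = h T n%:R * model1_state T c x0 n.
  apply: (model1_state_grid T0 aT na ode) => k r kn /andP[kr rk].
  apply: bE; [exact: ltnW|by rewrite ltW|].
  by rewrite (lt_le_trans rk)// (le_trans _ na)// ler_nat.
have := @model1_stage T a b x0 (c n) x n%:R t T0 aT ode.
rewrite ler0n nt ta => /(_ isT isT) h1.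
have /h1 : forall r, n%:R < r < t -> b r = c n / h T r.
  move=> r /andP[nr rt]; apply: bE => //; last exact: lt_le_trans ta.
  by rewrite ltW// (lt_le_trans rt).
rewrite xn [X in _ = X + _]mulrC mulrA mulVf// mul1r => /(congr1 (fun z => h T t * z)).
rewrite mulrC divfK// => ->; field.
by rewrite hn ht.
Qed.

End Flow.

(** * Closed form of the cost *)

Section Cost.
Context {R : realType}.
Implicit Types (T : nat) (t : R).
Local Notation h := (@riccati R).
Local Notation mu := (@lebesgue_measure R).

(** Nothing relates f(T) to the step values, so the integrand is written with a separate indicator
    of the point T, which has measure 0. *)
Lemma Rintegral_step T (f : R -> R) (U : nat -> R) : (0 < T)%N ->
  (forall t, 0 <= f t) ->
  (forall k t, (k < T)%N -> k%:R <= t < k.+1%:R -> f t = U k) ->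
  \int[mu]_(t in `[0, T%:R]) f t = \sum_(k < T) U k.
Proof.
move=> T0 f0 fU.
have U0 (k : 'I_T) : 0 <= U k.
  by rewrite -(fU k k%:R (ltn_ord k))// lexx ltr_nat ltnSn.
pose D (k : nat) : set (measurableTypeR R) := `[k%:R, k.+1%:R[%classic.
pose E : set (measurableTypeR R) := [set T%:R].
have mD k : measurable (D k) by exact: measurable_itv.
have mE : measurable E by exact: measurable_set1.
rewrite /Rintegral (_ : (\int[mu]_(t in `[0%R, T%:R]) (f t)%:E)%E =
  (\int[mu]_(t in `[0%R, T%:R]) (\sum_(k < T) (U k)%:E * (\1_(D k) t)%:E +
     (f T%:R)%:E * (\1_E t)%:E))%E); last first.
  apply: eq_integral => t; rewrite inE/= in_itv/= => t0T.
  have [t0 tT] := andP t0T; have [<-|tNT] := eqVneq T%:R t.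
    rewrite big1 ?add0e => [|k _]; first by rewrite indicE mem_set// mule1.
    rewrite indicE memNset ?mule0// /D/= in_itv/= => /andP[_].
    by rewrite ltr_nat ltnNge ltn_ord.
  have {tNT tT}tT : t < T%:R by rewrite lt_neqAle eq_sym tNT.
  have [iT it ti] := stage_bounds T0 t0T.
  have tr := truncn_itv t0.
  have kT : (Num.truncn t < T)%N.
    by rewrite -(@ltr_nat R); case/andP: tr => tr _; exact: le_lt_trans tr tT.
  rewrite (bigD1 (Ordinal kT))//= indicE mem_set; last by rewrite /D/= in_itv.
  rewrite mule1 indicE memNset ?mule0 ?adde0; last first.
    by move=> /= tTE; rewrite tTE ltxx in tT.
  rewrite big1 ?adde0 => [|k kt]; first by rewrite (fU _ _ kT tr).
  rewrite indicE memNset ?mule0// /D/= in_itv/= => ktr.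
  move/eqP: kt; apply; apply: val_inj => /=.
  by apply/esym/eqP; rewrite truncn_eq.
pose D0 : set (measurableTypeR R) := `[0, T%:R]%classic.
have mI : measurable D0 by exact: measurable_itv.
have m1 (A : set (measurableTypeR R)) (c : R) : measurable A ->
    measurable_fun D0 (fun t : measurableTypeR R => (c%:E * (\1_A t)%:E)%E).
  move=> mA; apply: emeasurable_funM => //.
  by apply/measurable_EFinP; exact: measurable_indic.
have n1 (A : set (measurableTypeR R)) (c : R) (t : measurableTypeR R) : 0 <= c ->
    (0 <= c%:E * (\1_A t)%:E)%E by move=> c0; rewrite mule_ge0 ?lee_fin.
have i1 (A : set (measurableTypeR R)) (c : R) : measurable A -> 0 <= c ->
    (\int[mu]_(t in `[0%R, T%:R]) (c%:E * (\1_A t)%:E) =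
     c%:E * mu (A `&` D0))%E.
  move=> mA c0; rewrite ge0_integralZl ?lee_fin// ?integral_indic//.
    by apply/measurable_EFinP; exact: measurable_indic.
rewrite ge0_integralD//; last 4 first.
- by move=> t _; apply: sume_ge0 => k _; exact: n1.
- by apply: emeasurable_sum => k _; exact: m1.
- by move=> t _; exact: n1.
- exact: m1.
rewrite ge0_integral_sum//; last 2 first.
- by move=> k; exact: m1.
- by move=> k t _; exact: n1.
rewrite i1// [X in (_ + _ * X)%E](_ : _ = 0)%E; last first.
  apply/eqP; rewrite eq_le measure_ge0 andbT -(lebesgue_measure_set1 T%:R).
  by apply: le_measure; rewrite ?inE//; first [exact: measurableI|exact: subIsetl].
rewrite mule0 adde0 (_ : \sum_(k < T) _ = \sum_(k < T) (U k)%:E)%E; last first.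
  apply: eq_bigr => k _; rewrite i1//.
  rewrite setIidl; last first.
    move=> t; rewrite /D /D0/= !in_itv/= => /andP[kt tk].
    rewrite (le_trans _ kt)//= (ltW (lt_le_trans tk _))//.
    by rewrite ler_nat ltn_ord.
  rewrite lebesgue_measure_itv/= lte_fin ltr_nat ltnSn -EFinB -natr1.
  by rewrite addrAC subrr add0r mule1.
by rewrite sumEFin.
Qed.

Lemma model1_cost T (b : R -> R) (c : nat -> R) (x0 : R) (x : R -> R) :
  (0 < T)%N -> ode_solution T%:R (model1 T b) x0 x ->
  (forall k r, (k < T)%N -> k%:R <= r < k.+1%:R -> b r = c k / h T r) ->
  lqr_cost T 0 (fun t => model1 T b t (x t)) x =
  x0 ^+ 2 / h T 0 + \sum_(k < T) c k ^+ 2 / (T%:R * (h T k%:R * h T k.+1%:R)).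
Proof.
move=> T0 ode bE.
have T0' : T%:R != 0 :> R by rewrite pnatr_eq0 -lt0n.
have hN0 k : (k <= T)%N -> h T k%:R != 0.
  by move=> kT; rewrite riccati_neq0// ler_nat.
pose y k := model1_state T c x0 k.
pose U k : R := - T%:R * y k + c k / h T k%:R.
have uE k r : (k < T)%N -> k%:R <= r < k.+1%:R -> model1 T b r (x r) = U k.
  move=> kT kr; have [kr1 kr2] := andP kr.
  have rT : r <= T%:R by rewrite (le_trans (ltW kr2))// ler_nat.
  have kr' : k%:R <= r <= k.+1%:R by rewrite kr1 ltW.
  have xr := @model1_state_flow R T T%:R b c x0 x k r T0 (lexx _) kr' rT ode.
  rewrite /model1 xr => [|k' r' k'k k'r' _]; last first.
    by apply: bE k'r'; exact: leq_ltn_trans kT.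
  rewrite (bE _ _ kT kr) /gain -/(h T r) /U -/(y k).
  have hk := hN0 k (ltnW kT); have hr : h T r != 0 by rewrite riccati_neq0.
  have hrE : h T r = h T k%:R - T%:R * (r - k%:R) by rewrite /riccati; ring.
  move: hk hr hrE; move: (h T r) (h T k%:R) => p q q0 p0 pE.
  by rewrite pE in p0 *; field; rewrite q0 p0.
rewrite /lqr_cost (@Rintegral_step T _ (fun k => U k ^+ 2))//; last first.
  by move=> k t kT kt; rewrite real_normK ?num_real// (uE k).
rewrite real_normK ?num_real// (model1_state_grid (c := c) T0 (lexx _) (lexx _) ode); last first.
  by move=> k r kT /andP[kr rk]; apply: bE; rewrite ?(ltW kr).
rewrite riccatiT mul1r -/(y T).
(* The term h(n) y(n)^2 = x(n)^2 / h(n) is the optimal cost to go from x(n). In one stage the cross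
   terms in y c cancel, and the excess over it is c_n^2 / h(n)^2 (1 / T + 1 / h(n + 1)), which is
   the new summand since h(n) = h(n + 1) + T. *)
suff H n : (n <= T)%N -> T%:R^-1 * (\sum_(k < n) U k ^+ 2) + h T n%:R * y n ^+ 2 =
    x0 ^+ 2 / h T 0 + \sum_(k < n) c k ^+ 2 / (T%:R * (h T k%:R * h T k.+1%:R)).
  by rewrite -H// riccatiT mul1r.
elim: n => [_|n IH nT].
  rewrite !big_ord0 mulr0 add0r addr0 /y /model1_state big_ord0 addr0.
  by field; exact: (hN0 0%N).
rewrite big_ord_recr [in RHS]big_ord_recr/= addrA -IH ?(ltnW nT)//.
have -> : y n.+1 = y n + c n / (h T n%:R * h T n.+1%:R).
  by rewrite /y /model1_state big_ord_recr/= addrA.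
rewrite /U.
have h0 := hN0 n (ltnW nT); have h1 := hN0 n.+1 nT.
have hE : h T n%:R = h T n.+1%:R + T%:R by rewrite riccatiS subrK.
move: h0 h1 hE; move: (h T n%:R) (h T n.+1%:R) (y n) => p q z p0 q0 pE.
rewrite pE in p0 *.
by field; rewrite p0 q0 T0'.
Qed.

End Cost.

(** * Controllers fitted by the three methods *)

Section Superposition.
Context {R : realType}.
Implicit Types (T : nat) (t : R).
Local Notation h := (@riccati R).

(** The state at time t by the formula of stage i. It is linear in (x0, c), so the influence of each
    noise can be followed separately, starting from state 0. *)
Definition model1_flow T (c : nat -> R) (x0 : R) (i : nat) t : R :=
  h T t * model1_state T c x0 i + c i * (t - i%:R) / h T i%:R.

Lemma model1_state_sum T (I : finType) (g : I -> R) (e : I -> nat -> R) (x0 : R) n :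
  model1_state T (fun l => \sum_p g p * e p l) x0 n =
  x0 / h T 0 + \sum_p g p * model1_state T (e p) 0 n.
Proof.
rewrite /model1_state; congr (_ + _).
under [in RHS]eq_bigr do rewrite mul0r add0r mulr_sumr.
rewrite exchange_big/=; apply: eq_bigr => k _.
by rewrite mulr_suml; apply: eq_bigr => p _; rewrite mulrA.
Qed.

Lemma model1_flow_sum T (I : finType) (g : I -> R) (e : I -> nat -> R) (x0 : R) i t :
  model1_flow T (fun l => \sum_p g p * e p l) x0 i t =
  h T t / h T 0 * x0 + \sum_p g p * model1_flow T (e p) 0 i t.
Proof.
rewrite /model1_flow model1_state_sum mulrDr -addrA.
congr (_ + _); first by ring.
rewrite mulr_sumr -mulrA mulr_suml -big_split/=; apply: eq_bigr => p _.
by ring.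
Qed.

Lemma model1_state0 T (c : nat -> R) n :
  (forall l, (l < n)%N -> c l = 0) -> model1_state T c 0 n = 0.
Proof.
move=> c0; rewrite /model1_state mul0r add0r big1// => k _.
by rewrite c0// mul0r.
Qed.

Lemma model1_stateS T (c : nat -> R) (x0 : R) n :
  model1_state T c x0 n.+1 =
  model1_state T c x0 n + c n / (h T n%:R * h T n.+1%:R).
Proof. by rewrite /model1_state big_ord_recr/= addrA. Qed.

(** The sum telescopes: T / (h(k) h(k + 1)) = 1 / h(k + 1) - 1 / h(k), and h(0) - h(n) = T n. *)
Lemma sum_inv_riccati T n : (n <= T)%N ->
  \sum_(k < n) (h T k%:R * h T k.+1%:R)^-1 = n%:R / (h T 0 * h T n%:R).
Proof.
have hN0 k : (k <= T)%N -> h T k%:R != 0.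
  by move=> kT; rewrite riccati_neq0// ler_nat.
elim: n => [_|n IH nT]; first by rewrite big_ord0 mul0r.
rewrite big_ord_recr/= IH ?(ltnW nT)//.
have h0 := hN0 _ (ltnW nT); have h1 := hN0 _ nT.
have hz : h T 0 != 0 := hN0 0%N isT.
have hnE : h T n%:R = h T 0 - T%:R * n%:R by rewrite /riccati; ring.
have hSE : h T n.+1%:R = h T 0 - T%:R * n%:R - T%:R by rewrite /riccati -natr1; ring.
rewrite hnE hSE in h0 h1 *; rewrite -natr1.
move: hz h0 h1; move: (h T 0) (T%:R : R) (n%:R : R) => p q r p0 q0 r0.
by field; rewrite p0 q0 r0.
Qed.

End Superposition.

(** * The fitted parameter b as a combination of the noises *)

Section Fit.
Context {R : realType}.
Implicit Types (T N : nat) (eps t : R).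
Local Notation h := (@riccati R).

(** Common to the three methods, which differ only in the paths in use at time t and in their
    starting times [s]. The starting points [x0] disappear from b. *)
Lemma least_squares_solver T eps (I : finType) (K : R -> pred I)
    (uhat xhat : I -> R -> R) (b : R -> R) t (s x0 z : I -> R) :
  least_squares T K uhat xhat b -> t \in `[0, T%:R] -> (0 < #|K t|)%N ->
  (forall i, K t i -> [/\ s i <= T%:R, uhat i t = solver_u T eps (s i) (x0 i) (z i) t &
     xhat i t = solver_x T eps (s i) (x0 i) (z i) t]) ->
  b t = eps * (#|K t|%:R^-1 * \sum_(i | K t i) h T (s i) * z i) / h T t.
Proof.
move=> ls tT K0 KE; rewrite (least_squares_mean ls tT K0).
rewrite mulrCA -mulrA; congr (_ * _); rewrite mulr_sumr mulr_suml.
apply: eq_bigr => i Ki; have [sT -> ->] := KE i Ki.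
rewrite solver_residual// ?mulrA//.
by move: tT; rewrite in_itv/= => /andP[].
Qed.

Section VanillaFit.
Variables (T N : nat) (eps : R) (X Z : 'I_(N * T) -> R) (b : R -> R).
Hypotheses (T0 : (0 < T)%N) (N0 : (0 < N)%N).

Definition vanilla_coef (j : 'I_(N * T)) : R := eps / (N * T)%:R * h T 0.

Lemma vanilla_fit t : vanilla_run eps X Z b -> t \in `[0, T%:R] ->
  b t = (\sum_j vanilla_coef j * Z j) / h T t.
Proof.
move=> run tT.
rewrite (@least_squares_solver T eps _ _ _ _ _ t (fun=> 0) X Z run tT)//.
  rewrite card_ord -!mulr_sumr /vanilla_coef; ring.
by rewrite card_ord muln_gt0 N0.
Qed.

End VanillaFit.

Section DAggerFit.
Variables (T N : nat) (eps : R) (X : 'I_N -> R) (Z : nat -> 'I_N -> R).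
Variables (b0 b : R -> R) (x : 'I_N -> R -> R).
Hypothesis N0 : (0 < N)%N.
Hypothesis run : dagger_run T eps X Z b0 x b.

Lemma dagger_fit0E t : t \in `[0, T%:R] ->
  b0 t = (eps / N%:R * h T 0 * \sum_j Z 0%N j) / h T t.
Proof.
move=> tT.
rewrite (@least_squares_solver T eps _ _ _ _ _ t (fun=> 0) X (Z 0%N) (dagger_fit0 run) tT)//.
  by rewrite card_ord -!mulr_sumr; ring.
by rewrite card_ord.
Qed.

(* In c_l the noise Z k j appears with coefficient (eps / N) * dagger_weight k l. *)
Definition dagger_weight (k l : nat) : R :=
  if (k <= l)%N then h T k%:R / l.+1%:R else 0.

Lemma card_dagger_data l : (l < T)%N ->
  #|[pred kj : 'I_T * 'I_N | (kj.1 <= l)%N]| = (N * l.+1)%N.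
Proof.
move=> lT; rewrite -sum1_card.
transitivity (\sum_(k : 'I_T | (k <= l)%N) \sum_(j : 'I_N) 1)%N.
  by rewrite pair_big/=; apply: eq_bigl => p; rewrite andbT.
under eq_bigr do rewrite sum1_card card_ord.
by rewrite -(big_ord_widen _ (fun=> N) lT) sum_nat_const card_ord mulnC.
Qed.

Lemma dagger_fitE l t : (l < T)%N -> l%:R <= t < l.+1%:R ->
  b t = (\sum_(p : 'I_T * 'I_N) (eps / N%:R * Z p.1 p.2) * dagger_weight p.1 l)
        / h T t.
Proof.
move=> lT lt; have tl := stageE lT lt.
have tT : t \in `[0, T%:R].
  have [l1 l2] := andP lt; rewrite in_itv/= (le_trans _ l1)//=.
  by rewrite (le_trans (ltW l2))// ler_nat.
have KE : @dagger_data R N T t =i [pred kj : 'I_T * 'I_N | (kj.1 <= l)%N].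
  by move=> p; rewrite /dagger_data inE /= unfold_in tl.
have cK : #|@dagger_data R N T t| = (N * l.+1)%N.
  by rewrite (eq_card KE) card_dagger_data.
rewrite (@least_squares_solver T eps _ _ _ _ _ t (fun p : 'I_T * 'I_N => p.1%:R)
  (fun p : 'I_T * 'I_N => dagger_start X x p.1 p.2)
  (fun p : 'I_T * 'I_N => Z p.1 p.2) (dagger_fit run) tT).
- rewrite cK natrM; congr (_ / _); rewrite mulr_sumr mulr_sumr big_mkcond/=.
  apply: eq_bigr => p _; rewrite /dagger_data tl /dagger_weight.
  by case: ifP => _; rewrite ?mulr0// invfM; ring.
- by rewrite cK muln_gt0 N0.
- by move=> p _; split => //; rewrite ler_nat ltnW.
Qed.

End DAggerFit.

Section POPSFit.
Variables (T N : nat) (eps : R) (X : 'I_N -> R) (Z : nat -> 'I_N -> R).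
Variables (x : nat -> 'I_N -> R -> R) (b : nat -> R -> R).
Hypothesis N0 : (0 < N)%N.
Hypothesis run : pops_run T eps X Z x b.

(** Iterations after k overwrite the data only from time k + 1 on. For k = i there is no later
    restart, so no upper bound on t is imposed; this covers t = T. *)
Lemma pops_dataE i k j t : (k <= i)%N -> k%:R <= t -> ((k < i)%N -> t < k.+1%:R) ->
  pops_u T eps Z x i j t = solver_u T eps k%:R (x k j k%:R) (Z k j) t /\
  pops_x T eps Z x i j t = solver_x T eps k%:R (x k j k%:R) (Z k j) t.
Proof.
elim: i => [|i IH]; first by rewrite leqn0 => /eqP ->.
rewrite leq_eqVlt => /predU1P[->|ki] kt tk /=; first by rewrite ltNge kt.
rewrite ltnS in ki.
rewrite (lt_le_trans (tk _)) ?ltnS ?ler_nat ?ltnS//.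
apply: IH => // ki'; apply: tk; exact: ltnW.
Qed.

(** Counterpart of [dagger_weight]: only the paths restarted at l enter c_l. *)
Definition pops_weight (k l : nat) : R := if k == l then h T k%:R else 0.

(** The right-hand side does not depend on the iteration i: the parameter on stage l is frozen once
    iteration l is done. Hence the trajectories that produce the restart points already follow the
    final controller. *)
Lemma pops_fitE i l t : (i < T)%N -> (l <= i)%N -> l%:R <= t < l.+1%:R ->
  b i t = (\sum_(p : 'I_T * 'I_N) (eps / N%:R * Z p.1 p.2) * pops_weight p.1 l)
          / h T t.
Proof.
move=> iT li lt; have lT := leq_ltn_trans li iT; have [l1 l2] := andP lt.
have tT : t \in `[0, T%:R].
  rewrite in_itv/= (le_trans _ l1)//=.
  by rewrite (le_trans (ltW l2))// ler_nat.
rewrite (@least_squares_solver T eps _ _ _ _ _ t (fun=> l%:R)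
  (fun j => x l j l%:R) (Z l) (pops_fit run iT) tT).
- congr (_ / _); rewrite card_ord.
  rewrite -(pair_bigA _ (fun (k : 'I_T) (j : 'I_N) =>
    eps / N%:R * Z k j * pops_weight k l))/=.
  rewrite (bigD1 (Ordinal lT))//= [X in _ = _ + X]big1 ?addr0; last first.
    move=> k; rewrite -val_eqE /= => kl; rewrite big1// => j _.
    by rewrite /pops_weight (negbTE kl) mulr0.
  rewrite /pops_weight eqxx !mulr_sumr; apply: eq_bigr => j _; ring.
- by rewrite card_ord.
- move=> j _; split; first by rewrite ler_nat ltnW.
    by have [] := @pops_dataE i l j t li l1 (fun _ => l2).
  by have [] := @pops_dataE i l j t li l1 (fun _ => l2).
Qed.

End POPSFit.
End Fit.

(** * Noise amplification in DAgger *)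

Section HarmonicTail.
Context {R : realType}.

Definition harmonic_tail (k i : nat) : R :=
  \sum_(l < i) (if (k <= l)%N then l.+1%:R^-1 else 0).

Lemma harmonic_tailS k i :
  harmonic_tail k i.+1 = harmonic_tail k i + (if (k <= i)%N then i.+1%:R^-1 else 0).
Proof. by rewrite /harmonic_tail big_ord_recr. Qed.

Lemma harmonic_tail_ge0 k i : 0 <= harmonic_tail k i.
Proof. by apply: sumr_ge0 => l _; case: ifP. Qed.

Lemma harmonic_tail0 k i : (i <= k)%N -> harmonic_tail k i = 0.
Proof.
move=> ik; apply: big1 => l _.
by rewrite leqNgt (leq_trans (ltn_ord l) ik).
Qed.

(** Each 1 / (l + 1) occurs in the l + 1 tails with k <= l and contributes 1 in total. *)
Lemma sum_harmonic_tail i : \sum_(k < i) harmonic_tail k i = i%:R.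
Proof.
elim: i => [|i IH]; first by rewrite big_ord0.
under eq_bigr => k _ do rewrite harmonic_tailS -ltnS ltn_ord.
rewrite big_split/= big_ord_recr/= IH harmonic_tail0// addr0.
by rewrite sumr_const card_ord -[X in _ + X]mulr_natl divff// natr1.
Qed.

Lemma sum_shifted_harmonic_tail_sqr i (u : R) :
  \sum_(k < i.+1) (harmonic_tail k i + u) ^+ 2 =
  \sum_(k < i) harmonic_tail k i ^+ 2 + 2 * u * i%:R + i.+1%:R * u ^+ 2.
Proof.
rewrite -[in 2 * u * _](sum_harmonic_tail i) big_ord_recr/= harmonic_tail0// add0r.
have -> : i.+1%:R * u ^+ 2 = i%:R * u ^+ 2 + u ^+ 2 by rewrite -natr1; ring.
rewrite mulr_sumr addrA; congr (_ + _).
have -> : i%:R * u ^+ 2 = \sum_(k < i) u ^+ 2.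
  by rewrite sumr_const card_ord mulr_natl.
by rewrite -!big_split/=; apply: eq_bigr => k _; ring.
Qed.

(** Shifting all tails by tau / (i + 1) adds (2 i + tau) tau / (i + 1) to the sum of squares, and 2
    i + tau <= 2 (i + 1); this is where the constant 2 comes from. *)
Lemma sum_harmonic_tail_sqr_step i (tau : R) : 0 <= tau <= 1 ->
  \sum_(k < i) harmonic_tail k i ^+ 2 <= 2 * i%:R ->
  \sum_(k < i.+1) (harmonic_tail k i + tau / i.+1%:R) ^+ 2 <= 2 * (i%:R + tau).
Proof.
move=> /andP[tau0 tau1] IH; rewrite sum_shifted_harmonic_tail_sqr.
have i0 : 0 <= i%:R :> R by [].
have -> : i.+1%:R = i%:R + 1 :> R by rewrite natr1.
move: IH i0; move: (i%:R : R) (\sum_(_ < _) _) => p S Sp p0.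
have p1 : 0 < p + 1 by lra.
have -> : S + 2 * (tau / (p + 1)) * p + (p + 1) * (tau / (p + 1)) ^+ 2 =
    S + (2 * p + tau) * tau / (p + 1) by field; rewrite gt_eqF.
rewrite mulrDr lerD// ler_pdivrMr//; nra.
Qed.

Lemma sum_harmonic_tail_sqr i : \sum_(k < i) harmonic_tail k i ^+ 2 <= 2 * i%:R.
Proof.
elim: i => [|i IH]; first by rewrite big_ord0 mulr0.
have := @sum_harmonic_tail_sqr_step i 1; rewrite ler01 lexx => /(_ isT IH).
rewrite natr1; apply: le_trans; rewrite le_eqVlt; apply/orP; left; apply/eqP.
by apply: eq_bigr => k _; rewrite harmonic_tailS -ltnS ltn_ord div1r.
Qed.

End HarmonicTail.

(** * Size of the noise coefficients in the DAgger trajectory *)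

Section DAggerWeights.
Context {R : realType}.
Implicit Types (T : nat) (t : R).
Local Notation h := (@riccati R).

Lemma model1_flow_grid T (c : nat -> R) (x0 : R) i : (i < T)%N ->
  model1_flow T c x0 i i.+1%:R = h T i.+1%:R * model1_state T c x0 i.+1.
Proof.
move=> iT; rewrite /model1_flow model1_stateS.
have h0 : h T i%:R != 0 by rewrite riccati_neq0// ler_nat ltnW.
have h1 : h T i.+1%:R != 0 by rewrite riccati_neq0// ler_nat.
by rewrite -natr1 in h1 *; field; rewrite h0 h1.
Qed.

Lemma dagger_flow0 T k i t : (i < k)%N -> model1_flow T (dagger_weight T k) 0 i t = 0.
Proof.
move=> ik; rewrite /model1_flow model1_state0.
  by rewrite /dagger_weight leqNgt ik/= mulr0 !mul0r addr0.
by move=> l li; rewrite /dagger_weight leqNgt (ltn_trans li ik).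
Qed.

Lemma dagger_flow_bounds T k i t : (i < T)%N -> i%:R <= t <= i.+1%:R ->
  (k <= i)%N ->
  0 <= model1_flow T (dagger_weight T k) 0 i t <=
    harmonic_tail k i + (t - i%:R) / i.+1%:R.
Proof.
pose G k i : R := h T i%:R * model1_state T (dagger_weight T k) 0 i.
(* One stage of the induction. The value [G] at the grid point must carry a lower bound along with
   the upper one, since the feedback term - gain x has to compensate the weight h(k) > h(i) of an
   old noise. *)
have step k' i' t' : (i' < T)%N -> i'%:R <= t' <= i'.+1%:R -> (k' <= i')%N ->
    0 <= G k' i' -> i'%:R - k'%:R <= i'%:R * G k' i' ->
  [/\ 0 <= model1_flow T (dagger_weight T k') 0 i' t',
    model1_flow T (dagger_weight T k') 0 i' t' <= G k' i' + (t' - i'%:R) / i'.+1%:R &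
    i'.+1%:R - k'%:R <=
      i'.+1%:R * @model1_flow R T (dagger_weight T k') 0 i' i'.+1%:R].
  move=> iT /andP[it ti] ki G0 Gi.
  have hi : 0 < h T i'%:R by rewrite riccati_gt0// ler_nat ltnW.
  have flowE r : model1_flow T (dagger_weight T k') 0 i' r =
      (h T r * G k' i' + h T k'%:R * (r - i'%:R) / i'.+1%:R) / h T i'%:R.
    rewrite /model1_flow /G /dagger_weight ki.
    by field; rewrite gt_eqF//= nat1r.
  have hr (r : R) : h T r = h T i'%:R - T%:R * (r - i'%:R) by rewrite /riccati; ring.
  have ht : 0 <= h T t'.
    by rewrite ltW// riccati_gt0// (le_trans ti)// ler_nat.
  have kd : 0 <= i'%:R - k'%:R :> R by rewrite subr_ge0 ler_nat.
  rewrite (flowE t') (flowE i'.+1%:R) (hr k'%:R) -[i'.+1%:R]natr1.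
  have i0 : 0 <= i'%:R :> R by [].
  have hn1 : 0 <= h T i'%:R - T%:R.
    by rewrite -riccatiS ltW// riccati_gt0// ler_nat.
  have hS : h T (i'%:R + 1) = h T i'%:R - T%:R by rewrite natr1 riccatiS.
  rewrite hS {hS}.
  have T0 : 0 <= T%:R :> R by [].
  have i1 : 0 < i'%:R + 1 :> R by lra.
  have tau0 : 0 <= t' - i'%:R by rewrite subr_ge0.
  rewrite (hr t') in ht *.
  move: (t' - i'%:R) tau0 ht => tau tau0 ht.
  have -> : k'%:R - i'%:R = - (i'%:R - k'%:R) :> R by ring.
  move: kd Gi; have -> : i'%:R + 1 - k'%:R = i'%:R - k'%:R + 1 :> R by ring.
  have -> : i'%:R + 1 - i'%:R = 1 :> R by ring.
  move: hi hn1 G0 ht T0 i0 i1.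
  move: (T%:R : R) (i'%:R : R) (i'%:R - k'%:R : R) (G k' i') (h T i'%:R) => S n dl g p.
  move=> p0 pS1 g0 pS S0 n0 n1 dl0 ng.
  (* The grid inequality i G >= i - k, weakened to the factor i + 1. Both decompositions below have
     a multiple of (n + 1) g - dl as remainder, so this sign gives the upper bound and also the
     lower bound at the next grid point. *)
  have n1g : dl <= (n + 1) * g by rewrite mulrDl mul1r; lra.
  have pdl : 0 <= p - S * - dl by rewrite mulrN opprK addr_ge0 ?mulr_ge0// ltW.
  split.
  - apply: divr_ge0; last exact: ltW.
    apply: addr_ge0; first exact: mulr_ge0.
    by apply: divr_ge0; [exact: mulr_ge0|exact: ltW].
  - rewrite ler_pdivrMr//.
    have -> : (g + tau / (n + 1)) * p =
        (p - S * tau) * g + (p - S * - dl) * tau / (n + 1) +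
        S * tau * ((n + 1) * g - dl) / (n + 1) by field; rewrite gt_eqF.
    by rewrite lerDl divr_ge0 ?(ltW n1)// !mulr_ge0 ?subr_ge0.
  - rewrite mulrA ler_pdivlMr//.
    have -> : (n + 1) * ((p - S) * g + (p - S * - dl) * 1 / (n + 1)) =
        (dl + 1) * p + ((n + 1) * g - dl) * (p - S) by field; rewrite gt_eqF.
    by rewrite lerDl mulr_ge0// subr_ge0.
move=> iT it ki.
suff [G0 Gi GL] : [/\ 0 <= G k i, i%:R - k%:R <= i%:R * G k i & G k i <= harmonic_tail k i].
  have [-> F1 _] := step k i t iT it ki G0 Gi.
  by rewrite (le_trans F1)// lerD2r.
elim: i iT ki {it} => [_|i IH iT].
  rewrite leqn0 => /eqP ->; rewrite subrr mul0r /G model1_state0// mulr0.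
  by split => //; exact: harmonic_tail_ge0.
rewrite leq_eqVlt => /predU1P[->|ki].
  rewrite subrr /G model1_state0; last first.
    by move=> l li; rewrite /dagger_weight leqNgt li.
  by rewrite mulr0 mulr0; split => //; exact: harmonic_tail_ge0.
have [G0 Gi GL] := IH (ltnW iT) ki.
have ii : (i%:R <= i.+1%:R :> R) && (i.+1%:R <= i.+1%:R :> R).
  by apply/andP; split; rewrite ler_nat.
have [F0 F1 F2] := step k i i.+1%:R (ltnW iT) ii ki G0 Gi.
rewrite model1_flow_grid ?(ltnW iT)// -/(G k i.+1) in F0 F1 F2.
split => //; apply: (le_trans F1); rewrite harmonic_tailS -ltnS ki.
have -> : i.+1%:R - i%:R = 1 :> R by rewrite -natr1; ring.
by rewrite div1r lerD2r.
Qed.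

Lemma dagger_flow_sqr_sum T i t : (i < T)%N -> i%:R <= t <= i.+1%:R ->
  \sum_(k < T) model1_flow T (dagger_weight T k) 0 i t ^+ 2 <= 2 * t.
Proof.
move=> iT it; have [it1 it2] := andP it.
have tau : 0 <= t - i%:R <= 1 by rewrite subr_ge0 it1 lerBlDl natr1.
have := sum_harmonic_tail_sqr_step tau (@sum_harmonic_tail_sqr R i).
rewrite subrKC; apply: le_trans.
rewrite (big_ord_widen _ (fun k => (harmonic_tail k i + (t - i%:R) / i.+1%:R) ^+ 2) iT).
rewrite [leRHS]big_mkcond/=; apply: ler_sum => k _.
case: ifPn => [|]; rewrite ltnS => ki; last first.
  by rewrite dagger_flow0 ?expr0n// ltnNge.
have /andP[F0 F1] := dagger_flow_bounds iT it ki.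
by rewrite lerXn2r// nnegrE// (le_trans F0).
Qed.

End DAggerWeights.

(** * Expected costs *)

Section ExpectedCost.
Context {R : realType} {d : measure_display} {W : measurableType d}.
Variables (P : probability W R) (T : nat).
Hypothesis T0 : (0 < T)%N.
Local Notation h := (@riccati R).

(** The closed form of the cost contains no products c_k c_l, so only each second moment is needed,
    although in DAgger the coefficients of different stages share noises. *)
Lemma expected_model1_cost (m s : R) (J : finType) (Z : J -> {RV P >-> R})
    (g : nat -> J -> R) (b : W -> R -> R) (x0 : R) (x : W -> R -> R) :
  0 <= s -> (forall j, has_normal_law m s (Z j)) ->
  (forall j k, j != k -> independent2 P (Z j) (Z k)) ->
  (forall w, ode_solution T%:R (model1 T (b w)) x0 (x w)) ->
  (forall w l r, (l < T)%N -> l%:R <= r < l.+1%:R ->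
    b w r = (\sum_j g l j * Z j w) / h T r) ->
  'E_P[(fun w => lqr_cost T 0 (fun t => model1 T (b w) t (x w t)) (x w))%R]%E =
  (x0 ^+ 2 / h T 0 + \sum_(l < T) (m ^+ 2 * (\sum_j g l j) ^+ 2 +
     s ^+ 2 * \sum_j g l j ^+ 2) / (T%:R * (h T l%:R * h T l.+1%:R)))%:E.
Proof.
move=> s0 nZ iZ ode bE.
pose S l w := \sum_j g l j * Z j w.
pose k (l : nat) := (T%:R * (h T l%:R * h T l.+1%:R))^-1.
have S2 l : S l \in Lfun P 2%:E.
  by apply: Lfun2_sum => j; apply: Lfun2Z; exact: normal_law_Lfun2 s0 (nZ j).
have SS1 l : (fun w => S l w ^+ 2) \in Lfun P 1.
  rewrite (_ : (fun w => _) = S l \* S l); first exact: Lfun2_mul_Lfun1.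
  by apply/funext => w; rewrite /= expr2.
have kS1 l : (fun w => k l * S l w ^+ 2) \in Lfun P 1.
  rewrite (_ : (fun w => _) = k l \o* (fun w => S l w ^+ 2)).
    exact: Lfun_scale.
  by apply/funext => w /=; rewrite mulrC.
rewrite (_ : (fun w => _) = (cst (x0 ^+ 2 / h T 0) \+
    (fun w => \sum_(l < T) k l * S l w ^+ 2)))%R; last first.
  apply/funext => w; rewrite (@model1_cost _ T (b w) (S^~ w) x0)//; last exact: bE.
  by congr (_ + _); apply: eq_bigr => l _; rewrite mulrC.
have sum1 : (fun w => \sum_(l < T) k l * S l w ^+ 2) \in Lfun P 1.
  rewrite (_ : (fun w => _) = \sum_(l < T) (fun w => k l * S l w ^+ 2)).
    by apply: rpred_sum => l _; exact: kS1.
  by apply/funext => w; rewrite fct_sumE.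
rewrite expectationD//; last exact: Lfun_cst.
rewrite expectation_cst EFinD; congr (_ + _)%E.
rewrite expectation_bigsum; last by move=> l; exact: kS1.
rewrite -sumEFin; apply: eq_bigr => l _.
rewrite (_ : (fun w => _) = k l \o* (fun w => S l w ^+ 2))%R; last first.
  by apply/funext => w /=; rewrite mulrC.
rewrite expectationZl ?SS1// (expectation_sqr_noise_sum s0 nZ iZ).
by rewrite -EFinM mulrC.
Qed.

End ExpectedCost.

Section SumSub.
Context {R : realType}.

Lemma sum_sub_nat (a : R) n :
  \sum_(k < n) (a - k%:R) = n%:R * a - n%:R * (n%:R - 1) / 2.
Proof.
elim: n => [|n IH]; first by rewrite big_ord0 !mul0r subrr.
by rewrite big_ord_recr/= IH -natr1; field.
Qed.

Lemma sum_sub_nat_sqr (a : R) n :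
  \sum_(k < n) (a - k%:R) ^+ 2 =
  n%:R * a ^+ 2 - a * (n%:R * (n%:R - 1)) + n%:R * (n%:R - 1) * (2 * n%:R - 1) / 6.
Proof.
elim: n => [|n IH]; first by rewrite big_ord0 !mul0r mulr0 subrr addr0.
by rewrite big_ord_recr/= IH -[n.+1%:R]natr1; field.
Qed.

End SumSub.

(** * Values and bounds of the expected excess costs *)

Section CostBounds.
Context {R : realType}.
Variables (T N : nat) (eps m s : R).
Hypotheses (T0 : (0 < T)%N) (N0 : (0 < N)%N).
Local Notation h := (@riccati R).

Let TR0 : 0 < T%:R :> R. Proof. by rewrite ltr0n. Qed.
Let NR0 : 0 < N%:R :> R. Proof. by rewrite ltr0n. Qed.

Let h_gt0 (k : nat) : (k <= T)%N -> 0 < h T k%:R.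
Proof. by move=> kT; rewrite riccati_gt0// ler_nat. Qed.

(** All c_l are equal and carry h(0)^2; the stage factors sum to 1 / h(0), which leaves h(0) = T^2 +
    1. *)
Lemma vanilla_cost_sum :
  \sum_(l < T) (m ^+ 2 * (\sum_(j < N * T) vanilla_coef eps j) ^+ 2 +
     s ^+ 2 * \sum_(j < N * T) vanilla_coef eps j ^+ 2) /
       (T%:R * (h T l%:R * h T l.+1%:R)) =
  (T%:R ^+ 2 + 1) * (m ^+ 2 + s ^+ 2 / (N * T)%:R) * eps ^+ 2.
Proof.
have sc (x : R) : \sum_(j < N * T) x = (N * T)%:R * x.
  by rewrite sumr_const card_ord mulr_natl.
rewrite /vanilla_coef !sc -mulr_sumr {sc}.
have h00 : 0 < h T 0 by exact: (@h_gt0 0).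
under eq_bigr do rewrite invfM.
rewrite -mulr_sumr sum_inv_riccati// riccatiT.
have -> : h T 0 = T%:R ^+ 2 + 1 by rewrite /riccati subr0 expr2.
have n0 : (N * T)%:R != 0 :> R by rewrite pnatr_eq0 -lt0n muln_gt0 N0.
move: n0; move: ((N * T)%:R : R) => n n0.
have : T%:R ^+ 2 + 1 != 0 :> R by rewrite gt_eqF// ltr_wpDl ?sqr_ge0.
by move=> t0; field; rewrite n0 t0 gt_eqF.
Qed.

Lemma sum_pair_fst (F : nat -> R) :
  \sum_(p : 'I_T * 'I_N) F p.1 = N%:R * \sum_(k < T) F k.
Proof.
rewrite -(pair_bigA _ (fun (k : 'I_T) (j : 'I_N) => F k))/= mulr_sumr.
by apply: eq_bigr => k _; rewrite sumr_const card_ord mulr_natl.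
Qed.

Lemma pops_cost_sum :
  \sum_(l < T) (m ^+ 2 * (\sum_(p : 'I_T * 'I_N) eps / N%:R * pops_weight T p.1 l) ^+ 2 +
     s ^+ 2 * \sum_(p : 'I_T * 'I_N) (eps / N%:R * pops_weight T p.1 l) ^+ 2) /
       (T%:R * (h T l%:R * h T l.+1%:R)) <=
  3 * (m ^+ 2 + s ^+ 2 / N%:R) * eps ^+ 2.
Proof.
set K := (m ^+ 2 + s ^+ 2 / N%:R) * eps ^+ 2.
have K0 : 0 <= K by rewrite mulr_ge0 ?sqr_ge0// addr_ge0 ?sqr_ge0// divr_ge0 ?sqr_ge0.
have term (l : 'I_T) : (m ^+ 2 * (\sum_(p : 'I_T * 'I_N) eps / N%:R * pops_weight T p.1 l) ^+ 2 +
     s ^+ 2 * \sum_(p : 'I_T * 'I_N) (eps / N%:R * pops_weight T p.1 l) ^+ 2) /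
       (T%:R * (h T l%:R * h T l.+1%:R)) = K * (h T l%:R / (T%:R * h T l.+1%:R)).
  rewrite (sum_pair_fst (fun k => eps / N%:R * pops_weight T k l)).
  rewrite (sum_pair_fst (fun k => (eps / N%:R * pops_weight T k l) ^+ 2)).
  rewrite (bigD1 l)//= big1 => [|k kl]; last first.
    by rewrite /pops_weight -val_eqE/= in kl *; rewrite (negbTE kl) mulr0.
  rewrite (bigD1 l)//= big1 => [|k kl]; last first.
    by rewrite /pops_weight -val_eqE/= in kl *; rewrite (negbTE kl) mulr0 expr0n.
  rewrite /pops_weight eqxx !addr0 /K.
  have h1 := h_gt0 (ltnW (ltn_ord l)); have h2 := h_gt0 (ltn_ord l).
  by field; rewrite !gt_eqF.
rewrite (eq_bigr _ (fun l _ => term l)) -mulr_sumr -mulrA mulrC -/K.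
rewrite ler_wpM2r//.
(* The stage factor is 1 / h(l + 1) + 1 / T. Before the last stage h(l + 1) >= T, so it is at most 2
   / T; on the last stage h(T) = 1 costs the additional 1 - 1 / T. The total is at most 2 + 1 =
   3. *)
have bound (l : 'I_T) : h T l%:R / (T%:R * h T l.+1%:R) <=
    2 / T%:R + (if l == T.-1 :> nat then 1 - T%:R^-1 else 0).
  have h2 := h_gt0 (ltn_ord l).
  rewrite ler_pdivrMr; last exact: mulr_gt0.
  have -> : h T l%:R = h T l.+1%:R + T%:R by rewrite riccatiS subrK.
  case: ifPn => [/eqP lT|lT].
    rewrite lT prednK// riccatiT mulr1 mulrDl mulrBl divfK ?gt_eqF//.
    by rewrite mulVf ?gt_eqF// mul1r; lra.
  rewrite addr0 mulrA divfK ?gt_eqF// mulrC mulr2n mulrDr mulr1 lerD2l.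
  have lT1 : (l.+2 <= T)%N by rewrite ltn_neqAle ltn_ord andbT; move: lT; rewrite -eqSS prednK.
  rewrite /riccati -[leLHS]mulr1 -[leLHS]addr0 lerD// ler_wpM2l//.
  by rewrite lerBrDr nat1r ler_nat.
apply: (le_trans (ler_sum _ (fun l _ => bound l))).
rewrite big_split/= sumr_const card_ord -big_mkcond/=.
rewrite (big_pred1 (Ordinal (eq_leq (prednK T0) : (T.-1 < T)%N))); last by move=> l; rewrite /= -val_eqE.
rewrite -[_ *+ T]mulr_natr divfK ?gt_eqF//.
by have := invr_ge0 (T%:R : R); rewrite ler0n; lra.
Qed.

(** In the last stage term the divisor is T (T + 1). The mean of the h(k) is T (T + 1) / 2 + 1,
    whose square yields T^2 / 4 after division; the sum of the h(k)^2, about T^5 / 3, yields T / (3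
    N). *)
Lemma dagger_cost_sum :
  (T%:R ^+ 2 * m ^+ 2 / 4 + T%:R * s ^+ 2 / (3 * N%:R)) * eps ^+ 2 <=
  \sum_(l < T) (m ^+ 2 * (\sum_(p : 'I_T * 'I_N) eps / N%:R * dagger_weight T p.1 l) ^+ 2 +
     s ^+ 2 * \sum_(p : 'I_T * 'I_N) (eps / N%:R * dagger_weight T p.1 l) ^+ 2) /
       (T%:R * (h T l%:R * h T l.+1%:R)).
Proof.
have lT : (T.-1 < T)%N by rewrite prednK.
rewrite (bigD1 (Ordinal lT))//= -[leLHS]addr0; apply: lerD; last first.
  apply: sumr_ge0 => l _; apply: divr_ge0; last first.
    by rewrite ltW// !mulr_gt0// h_gt0// ltnW.
  by rewrite addr_ge0// mulr_ge0 ?sqr_ge0// sumr_ge0// => p _; exact: sqr_ge0.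
rewrite (sum_pair_fst (fun k => eps / N%:R * dagger_weight T k T.-1)).
rewrite (sum_pair_fst (fun k => (eps / N%:R * dagger_weight T k T.-1) ^+ 2)).
have wE (k : 'I_T) : dagger_weight T k T.-1 = h T k%:R / T%:R.
  by rewrite /dagger_weight -ltnS prednK// ltn_ord.
under eq_bigr do rewrite wE.
under [X in _ + _ * (_ * X)]eq_bigr do rewrite wE.
have hE (k : nat) : h T k%:R = T%:R * (T%:R - k%:R) + 1 by [].
have sum1 : \sum_(k < T) h T k%:R = T%:R * (T%:R * (T%:R + 1) / 2 + 1).
  rewrite (eq_bigr (fun k : 'I_T => T%:R * (T%:R - k%:R) + 1))//.
  by rewrite big_split/= -mulr_sumr sum_sub_nat sumr_const card_ord; field.
have sum2 : T%:R ^+ 4 * (T%:R + 1) / 3 <= \sum_(k < T) h T k%:R ^+ 2.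
  (* The summand 1 of h(k) = T (T - k) + 1 is dropped before squaring. *)
  apply: (@le_trans _ _ (\sum_(k < T) T%:R ^+ 2 * (T%:R - k%:R) ^+ 2)).
    rewrite -mulr_sumr sum_sub_nat_sqr; move: TR0; move: (T%:R : R) => x x0.
    have -> : x ^+ 2 * (x * x ^+ 2 - x * (x * (x - 1)) + x * (x - 1) * (2 * x - 1) / 6) =
      x ^+ 4 * (x + 1) / 3 + x ^+ 3 * (x + 1) / 6 by field.
    by rewrite lerDl divr_ge0// mulr_ge0 ?exprn_ge0 ?addr_ge0// ltW.
  apply: ler_sum => k _; rewrite hE -exprMn.
  have k0 : 0 <= T%:R * (T%:R - k%:R) :> R.
    by rewrite mulr_ge0// subr_ge0 ler_nat ltnW.
  by rewrite lerXn2r// ?nnegrE ?addr_ge0// lerDl.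
have h1 : h T T.-1%:R = T%:R + 1.
  by rewrite /riccati -{2}(prednK T0) -natr1; ring.
rewrite prednK// riccatiT h1 mulr1.
rewrite -mulr_sumr -mulr_suml sum1.
rewrite [X in _ + _ * (_ * X)](_ : _ = (eps / (N%:R * T%:R)) ^+ 2 * \sum_(k < T) h T k%:R ^+ 2); last first.
  rewrite mulr_sumr; apply: eq_bigr => k _; field.
  by rewrite !gt_eqF.
move: sum2; move: (\sum_(k < T) _) => S sum2.
rewrite ler_pdivlMr; last by rewrite mulr_gt0// addr_gt0.
have -> : m ^+ 2 * (N%:R * (eps / N%:R * (T%:R * (T%:R * (T%:R + 1) / 2 + 1) / T%:R))) ^+ 2 +
    s ^+ 2 * (N%:R * ((eps / (N%:R * T%:R)) ^+ 2 * S)) =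
    (m * eps) ^+ 2 * (T%:R * (T%:R + 1) / 2 + 1) ^+ 2 +
    (s * eps) ^+ 2 / (N%:R * T%:R ^+ 2) * S.
  by field; rewrite !gt_eqF.
have -> : (T%:R ^+ 2 * m ^+ 2 / 4 + T%:R * s ^+ 2 / (3 * N%:R)) * eps ^+ 2 *
      (T%:R * (T%:R + 1)) =
    (m * eps) ^+ 2 * (T%:R ^+ 3 * (T%:R + 1) / 4) +
    (s * eps) ^+ 2 / (N%:R * T%:R ^+ 2) * (T%:R ^+ 4 * (T%:R + 1) / 3).
  by field; rewrite !gt_eqF.
apply: lerD; last first.
  by rewrite ler_wpM2l// divr_ge0 ?sqr_ge0// mulr_ge0 ?sqr_ge0 ?ltW.
rewrite ler_wpM2l ?sqr_ge0//; move: TR0; move: (T%:R : R) => x x0.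
have -> : (x * (x + 1) / 2 + 1) ^+ 2 =
  x ^+ 3 * (x + 1) / 4 + (x ^+ 2 * (x + 1) / 4 + x * (x + 1) + 1) by field.
by rewrite lerDl !addr_ge0 ?divr_ge0 ?mulr_ge0 ?addr_ge0 ?exprn_ge0 ?ltW.
Qed.

End CostBounds.

(** * Distributions of the states *)

Section States.
Context {R : realType}.
Implicit Types (T N : nat) (eps t : R).
Local Notation h := (@riccati R).

(** One coefficient serves all of [0, T], which is then a single stage. This is the case of the
    vanilla controller and of the first DAgger controller. *)
Lemma model1_flow_const T a (b : R -> R) (x0 c : R) (x : R -> R) t :
  (0 < T)%N -> a <= T%:R -> 0 <= t <= a -> ode_solution a (model1 T b) x0 x ->
  (forall r, r \in `[0, T%:R] -> b r = c / h T r) ->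
  x t = h T t / h T 0 * x0 + c * t / h T 0.
Proof.
move=> T0 aT /andP[t0 ta] ode bE.
have ht : h T t != 0 by rewrite riccati_neq0// (le_trans ta).
have h0 : h T 0 != 0 by rewrite riccati_neq0.
have := @model1_stage R T a b x0 c x 0 t T0 aT ode.
rewrite lexx t0 ta (ode_init ode) => /(_ isT isT) E.
have /E : forall r, 0 < r < t -> b r = c / h T r.
  move=> r /andP[r0 rt]; apply: bE; rewrite in_itv/= ltW//=.
  by rewrite (le_trans (ltW rt))// (le_trans ta).
move=> /(congr1 (fun z => h T t * z)); rewrite mulrC divfK// => ->.
by field; rewrite ht h0.
Qed.

Section Vanilla.
Variables (T N : nat) (eps : R) (X Z : 'I_(N * T) -> R) (b : R -> R).
Hypotheses (T0 : (0 < T)%N) (N0 : (0 < N)%N).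
Hypothesis run : vanilla_run eps X Z b.

Lemma vanilla_stateE (x0 : R) (x : R -> R) t : 0 <= t <= T%:R ->
  ode_solution T%:R (model1 T b) x0 x ->
  x t = h T t / h T 0 * x0 + \sum_j (eps / (N * T)%:R * t) * Z j.
Proof.
move=> tT ode.
rewrite (@model1_flow_const T T%:R b x0 (\sum_j vanilla_coef eps j * Z j) x t)//; last first.
  by move=> r rT; exact: (vanilla_fit T0 N0 run).
congr (_ + _); rewrite /vanilla_coef -!mulr_sumr.
have h0 : h T 0 != 0 by rewrite riccati_neq0.
move: h0; move: (\sum_j Z j) (eps / _) (h T 0) => S e r r0.
by field.
Qed.

End Vanilla.

Lemma vanilla_xE T N eps (X Z : 'I_(N * T) -> R) j t :
  vanilla_x eps X Z j t = h T t / h T 0 * X j + eps * t * Z j.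
Proof. by rewrite /vanilla_x /solver_x -!/(riccati T _) subr0 [t * eps]mulrC. Qed.

Section DAgger.
Variables (T N : nat) (eps : R) (X : 'I_N -> R) (Z : nat -> 'I_N -> R).
Variables (b0 b : R -> R) (x : 'I_N -> R -> R).
Hypotheses (T0 : (0 < T)%N) (N0 : (0 < N)%N).
Hypothesis run : dagger_run T eps X Z b0 x b.

(** The middle term is the error of the first controller, inherited through the starting point at
    time k; the last term is the noise of the path itself. *)
Lemma dagger_xE k j t : (k < T)%N -> t <= T%:R ->
  dagger_x T eps X Z x k j t =
  h T t / h T 0 * X j + h T t / h T k%:R * (eps / N%:R) * k%:R * (\sum_j' Z 0%N j')
  + eps * (t - k%:R) * Z k j.
Proof.
move=> kT tT; have h0 : h T 0 != 0 by rewrite riccati_neq0.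
have hk : h T k%:R != 0 by rewrite riccati_neq0// ler_nat ltnW.
have startE : dagger_start X x k j =
    h T k%:R / h T 0 * X j + eps / N%:R * k%:R * \sum_j' Z 0%N j'.
  rewrite /dagger_start; case: eqP => [->|_].
    by rewrite mulr0 mul0r addr0 divff// mul1r.
  rewrite (@model1_flow_const T T%:R b0 (X j) (eps / N%:R * h T 0 * \sum_j Z 0%N j))//.
  - congr (_ + _); move: h0; move: (\sum_j _) (eps / _) (h T 0) => S e r r0.
    by field.
  - by rewrite ler0n ler_nat ltnW.
  - exact: dagger_ode run j.
  - by move=> r rT; exact: (dagger_fit0E N0 run).
rewrite /dagger_x /solver_x startE -!/(riccati T _).
move: (\sum_j' _) => S; move: h0 hk.
move: (h T t) (h T k%:R) (h T 0) (eps / N%:R) => p q r e r0 q0.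
by field; rewrite r0 q0.
Qed.

Lemma dagger_stateE (x0 : R) (y : R -> R) i t : (i < T)%N -> i%:R <= t <= i.+1%:R ->
  ode_solution T%:R (model1 T b) x0 y ->
  y t = h T t / h T 0 * x0 +
    \sum_(p : 'I_T * 'I_N) (eps / N%:R * model1_flow T (dagger_weight T p.1) 0 i t) * Z p.1 p.2.
Proof.
move=> iT it ode.
pose c l := \sum_(p : 'I_T * 'I_N) (eps / N%:R * Z p.1 p.2) * dagger_weight T p.1 l.
have tT : t <= T%:R by case/andP: it => _ ti; rewrite (le_trans ti)// ler_nat.
rewrite (@model1_state_flow R T T%:R b c x0 y i t T0 (lexx _) it tT ode); last first.
  by move=> k r ki kr _; apply: (dagger_fitE N0 run) => //; exact: leq_ltn_trans iT.
rewrite -/(model1_flow T c x0 i t).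
rewrite (model1_flow_sum T (fun p : 'I_T * 'I_N => eps / N%:R * Z p.1 p.2)
  (fun p => dagger_weight T p.1)).
by congr (_ + _); apply: eq_bigr => p _; rewrite mulrAC.
Qed.

End DAgger.

Section POPS.
Variables (T N : nat) (eps : R) (X : 'I_N -> R) (Z : nat -> 'I_N -> R).
Variables (x : nat -> 'I_N -> R -> R) (b : nat -> R -> R).
Hypotheses (T0 : (0 < T)%N) (N0 : (0 < N)%N).
Hypothesis run : pops_run T eps X Z x b.

(** The coefficient, during stage i, of a noise from an earlier stage. It is the same for the
    training paths and for the learned trajectory. *)
Definition pops_past_coef i t (k : nat) : R :=
  eps / N%:R * (h T t * model1_state T (pops_weight T k) 0 i).

Lemma pops_past_coef0 i t k : (i <= k)%N -> pops_past_coef i t k = 0.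
Proof.
move=> ik; rewrite /pops_past_coef model1_state0 ?mulr0// => l li.
by rewrite /pops_weight gtn_eqF// (leq_trans li).
Qed.

Lemma pops_stateE (x0 : R) (y : R -> R) i t : (i < T)%N -> i%:R <= t <= i.+1%:R ->
  ode_solution T%:R (model1 T (b T.-1)) x0 y ->
  y t = h T t / h T 0 * x0 +
    \sum_(p : 'I_T * 'I_N)
      (pops_past_coef i t p.1 + (if p.1 == i :> nat then eps / N%:R * (t - i%:R) else 0))
      * Z p.1 p.2.
Proof.
move=> iT it ode.
pose c l := \sum_(p : 'I_T * 'I_N) (eps / N%:R * Z p.1 p.2) * pops_weight T p.1 l.
have tT : t <= T%:R by case/andP: it => _ ti; rewrite (le_trans ti)// ler_nat.
have hi : h T i%:R != 0 by rewrite riccati_neq0// ler_nat ltnW.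
rewrite (@model1_state_flow R T T%:R (b T.-1) c x0 y i t T0 (lexx _) it tT ode); last first.
  move=> k r ki kr _; apply: (pops_fitE N0 run) => //; first by rewrite prednK.
  by rewrite -ltnS prednK// (leq_ltn_trans ki).
rewrite -/(model1_flow T c x0 i t).
rewrite (model1_flow_sum T (fun p : 'I_T * 'I_N => eps / N%:R * Z p.1 p.2)
  (fun p => pops_weight T p.1)).
congr (_ + _); apply: eq_bigr => p _; rewrite mulrAC; congr (_ * _).
rewrite /model1_flow /pops_past_coef mulrDr /pops_weight; congr (_ + _).
case: eqP => [->|_]; last by rewrite !mul0r mulr0.
by congr (_ * _); rewrite mulrAC divff// mul1r.
Qed.

(** At t = i + 1 the data already belong to the next restart, except at the final time; hence the
    strict bound for i below T - 1. *)
Lemma pops_dataXE i j t : (i < T)%N -> i%:R <= t <= i.+1%:R ->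
  ((i < T.-1)%N -> t < i.+1%:R) ->
  pops_x T eps Z x T.-1 j t = h T t / h T 0 * X j +
    (\sum_(p : 'I_T * 'I_N) pops_past_coef i t p.1 * Z p.1 p.2 + eps * (t - i%:R) * Z i j).
Proof.
move=> iT /andP[it ti] ti'.
have iT1 : (i <= T.-1)%N by rewrite -ltnS prednK.
have [_ ->] := @pops_dataE _ T N eps Z x T.-1 i j t iT1 it ti'.
have hi : h T i%:R != 0 by rewrite riccati_neq0// ler_nat ltnW.
pose c l := \sum_(p : 'I_T * 'I_N) (eps / N%:R * Z p.1 p.2) * pops_weight T p.1 l.
have xi : x i j i%:R = h T i%:R * model1_state T c (X j) i.
  have ode := pops_ode run j iT.
  have iTR : i%:R <= T%:R :> R by rewrite ler_nat ltnW.
  apply: (model1_state_grid T0 iTR (lexx _) ode) => k r ki /andP[kr rk].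
  (* The trajectory up to time i was driven by the controller of iteration i - 1; since k < i that
     iteration exists, and its parameter on stage k is the final one. *)
  have [i' ii'] : exists i', i = i'.+1 by case: (i) ki => // i' _; exists i'.
  rewrite ii' /=; apply: (pops_fitE N0 run); rewrite ?(ltW kr)//.
    by rewrite -ii' ltnW.
  by rewrite -ltnS -ii'.
rewrite /solver_x xi -!/(riccati T _) mulrA divfK// model1_state_sum mulrDr -addrA.
congr (_ + _); first by ring.
congr (_ + _); last by ring.
rewrite mulr_sumr; apply: eq_bigr => p _; rewrite /pops_past_coef; ring.
Qed.

End POPS.
End States.

(** * Comparison of the training data with the learned trajectories *)

Section Distributions.
Context {R : realType} {d d' : measure_display} {W : measurableType d}.
Context {W' : measurableType d'}.
Variables (P : probability W R) (Q : probability W' R).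
Variables (T N : nat) (eps m s : R).
Hypotheses (T0 : (0 < T)%N) (N0 : (0 < N)%N) (s0 : 0 <= s).
Local Notation h := (@riccati R).

Lemma training_noise_independent (I J : finType) (X : I -> {RV P >-> R})
    (Z : J -> {RV P >-> R}) (j k : J) :
  training_sample m s X Z -> j != k -> independent2 P (Z j) (Z k).
Proof.
move=> sXZ jk.
by have := @mutually_independent2 _ _ _ P _ _ (inr j) (inr k) (sample_indep sXZ) jk.
Qed.

Lemma training_init_noise_independent (I J : finType) (X : I -> {RV P >-> R})
    (Z : J -> {RV P >-> R}) (i : I) (j : J) :
  training_sample m s X Z -> independent2 P (X i) (Z j).
Proof.
move=> sXZ.
by have := @mutually_independent2 _ _ _ P _ _ (inl i) (inr j) (sample_indep sXZ) isT.
Qed.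

Lemma training_moments (I J : finType) (X : I -> {RV P >-> R})
    (Z : J -> {RV P >-> R}) (i : I) (a : R) (b : J -> R) (x : W -> R) :
  training_sample m s X Z ->
  (forall w, x w = a * X i w + \sum_j b j * Z j w) ->
  [/\ x \in Lfun P 2%:E, 'E_P[x]%E = (m * \sum_j b j)%:E &
      'V_P[x]%E = (a ^+ 2 + s ^+ 2 * \sum_j b j ^+ 2)%:E].
Proof.
move=> sXZ xE; rewrite (_ : x = fun w => a * X i w + \sum_j b j * Z j w).
  apply: init_noise_sum_moments => //.
  - exact: sample_noise sXZ.
  - by move=> j k; exact: training_noise_independent sXZ.
  - exact: sample_init sXZ i.
  - by move=> j; exact: training_init_noise_independent sXZ.
exact/funext.
Qed.

Lemma fresh_init_moments (I J : finType) (X : I -> {RV P >-> R})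
    (Z : J -> {RV P >-> R}) (X0 : {RV P >-> R}) (a : R) (b : J -> R) (x : W -> R) :
  training_sample m s X Z -> has_normal_law 0 1 X0 ->
  independent_of_family P X0 (joint_family X Z) ->
  (forall w, x w = a * X0 w + \sum_j b j * Z j w) ->
  [/\ x \in Lfun P 2%:E, 'E_P[x]%E = (m * \sum_j b j)%:E &
      'V_P[x]%E = (a ^+ 2 + s ^+ 2 * \sum_j b j ^+ 2)%:E].
Proof.
move=> sXZ nX0 iX0 xE; rewrite (_ : x = fun w => a * X0 w + \sum_j b j * Z j w).
  apply: init_noise_sum_moments => //.
  - exact: sample_noise sXZ.
  - by move=> j k; exact: training_noise_independent sXZ.
  - by move=> j; exact: (@independent_of_family2 _ _ _ P _ X0 (joint_family X Z) (inr j)).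
exact/funext.
Qed.

Lemma average_law_const (Y : {RV Q >-> R}) (n : nat) (X : 'I_n -> W -> R) (M V : R) :
  (0 < n)%N -> has_average_law P Y xpredT n X ->
  (forall i, [/\ X i \in Lfun P 2%:E, 'E_P[X i]%E = M%:E & 'V_P[X i]%E = V%:E]) ->
  'E_Q[Y]%E = M%:E /\ 'V_Q[Y]%E = V%:E.
Proof.
move=> n0 lawY mom.
have n0' : n%:R != 0 :> R by rewrite pnatr_eq0 -lt0n.
have [_ -> ->] := average_law_moments lawY
  (fun i _ => let: And3 a _ _ := mom i in a)
  (mu := fun=> M) (v := fun=> V)
  (fun i _ => let: And3 _ a _ := mom i in a)
  (fun i _ => let: And3 _ _ a := mom i in a).
have sc (x : R) : n%:R^-1 * \sum_(i < n) x = x.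
  rewrite (_ : \sum_(i < n) x = n%:R * x) ?mulKf//.
  by rewrite sumr_const card_ord mulr_natl.
by rewrite !sc addrK.
Qed.

Lemma sum_delta (J : finType) (j : J) (c : R) (F : J -> R) :
  \sum_k (if k == j then c else 0) * F k = c * F j.
Proof.
rewrite (bigD1 j)//= eqxx big1 ?addr0// => k /negbTE ->.
by rewrite mul0r.
Qed.

Lemma sum_delta1 (J : finType) (j : J) (c : R) :
  \sum_k (if k == j then c else 0) = c.
Proof. by rewrite -big_mkcond big_pred1_eq. Qed.

Lemma sum_delta_sqr (J : finType) (j : J) (c : R) :
  \sum_k (if k == j then c else 0) ^+ 2 = c ^+ 2.
Proof. by under eq_bigr do rewrite expr2; rewrite sum_delta eqxx expr2. Qed.

(** A training path contains eps t times one noise, the learned trajectory eps t times the mean of N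
    T noises: equal means, and the noise variance divided by N T. *)
Lemma vanilla_distribution (X Z : 'I_(N * T) -> {RV P >-> R}) (b : W -> R -> R)
    (t : R) (xhat : {RV Q >-> R}) (X0 : {RV P >-> R}) (x : W -> R -> R) :
  training_sample m s X Z ->
  (forall w, vanilla_run eps (X ^~ w) (Z ^~ w) (b w)) ->
  has_average_law P xhat xpredT (N * T)
    (fun (j : 'I_(N * T)) w => vanilla_x eps (X ^~ w) (Z ^~ w) j t) ->
  has_normal_law 0 1 X0 ->
  independent_of_family P X0 (joint_family X Z) ->
  (forall w, ode_solution T%:R (model1 T (b w)) (X0 w) (x w)) ->
  0 <= t <= T%:R ->
  [/\ 'E_Q[xhat]%E = 'E_P[x ^~ t]%E,
      'V_Q[xhat]%E = ((h T t / h T 0) ^+ 2 + s ^+ 2 * (eps * t) ^+ 2)%:E &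
      'V_P[x ^~ t]%E =
        ((h T t / h T 0) ^+ 2 + s ^+ 2 * ((eps * t) ^+ 2 / (N * T)%:R))%:E].
Proof.
move=> sXZ run lawY nX0 iX0 ode tT.
have n0 : (0 < N * T)%N by rewrite muln_gt0 N0.
have n0' : (N * T)%:R != 0 :> R by rewrite pnatr_eq0 -lt0n.
have [|_ -> ->] := @fresh_init_moments _ _ X Z X0 (h T t / h T 0)
    (fun=> eps / (N * T)%:R * t) (x ^~ t) sXZ nX0 iX0.
  by move=> w; exact: (vanilla_stateE T0 N0 (run w)) (ode w).
have sc (c : R) : \sum_(j < N * T) c = (N * T)%:R * c.
  by rewrite sumr_const card_ord mulr_natl.
rewrite !sc.
have [|-> ->] := average_law_const n0 lawY (M := m * (eps * t))
    (V := (h T t / h T 0) ^+ 2 + s ^+ 2 * (eps * t) ^+ 2).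
  move=> j; have [|? -> ->] := @training_moments _ _ X Z j (h T t / h T 0)
    (fun k => if k == j then eps * t else 0) (fun w => vanilla_x eps (X^~ w) (Z^~ w) j t) sXZ.
    by move=> w; rewrite sum_delta vanilla_xE.
  split => //; congr _%:E; first by rewrite sum_delta1.
  by rewrite sum_delta_sqr.
move: n0'; move: ((N * T)%:R : R) (h T t / h T 0) => n a n0'.
by split => //; congr _%:E; field.
Qed.

Lemma sum_pair_row (i : nat) (c : R) (F : nat -> 'I_N -> R) : (i < T)%N ->
  \sum_(p : 'I_T * 'I_N) (if p.1 == i :> nat then c else 0) * F p.1 p.2 =
  c * \sum_j F i j.
Proof.
move=> iT.
rewrite -(pair_bigA _ (fun (k : 'I_T) (j : 'I_N) => (if k == i :> nat then c else 0) * F k j))/=.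
rewrite (bigD1 (Ordinal iT))//= eqxx [X in _ + X]big1 ?addr0 ?mulr_sumr// => k.
rewrite -val_eqE /= => /negbTE ki; rewrite big1// => j _.
by rewrite ki mul0r.
Qed.

(** Discrete analogue of averaging (t - s)^2 over s in [0, t], which gives exactly t^2 / 3. *)
Lemma mean_sqr_sub_nat (t : R) (i : nat) : i%:R <= t ->
  t ^+ 2 / 3 <= i.+1%:R^-1 * \sum_(k < i.+1) (t - k%:R) ^+ 2.
Proof.
move=> it; rewrite sum_sub_nat_sqr.
have -> : i.+1%:R = i%:R + 1 :> R by rewrite natr1.
have : 0 <= i%:R :> R by [].
move: it; move: (i%:R : R) => x xt x0.
have x1 : x + 1 != 0 by rewrite gt_eqF// ltr_wpDl.
have -> : (x + 1)^-1 * ((x + 1) * t ^+ 2 - t * ((x + 1) * (x + 1 - 1)) +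
    (x + 1) * (x + 1 - 1) * (2 * (x + 1) - 1) / 6) =
    t ^+ 2 / 3 + ((2 * t - x) * (t - x) / 3 + x / 6) by field.
rewrite lerDl addr_ge0 ?divr_ge0// mulr_ge0 ?subr_ge0//; lra.
Qed.

Lemma dagger_distribution (X : 'I_N -> {RV P >-> R}) (Z : nat -> 'I_N -> {RV P >-> R})
    (b0 : W -> R -> R) (x0 : W -> 'I_N -> R -> R) (b : W -> R -> R)
    (t : R) (xhat : {RV Q >-> R}) (X0 : {RV P >-> R}) (x : W -> R -> R) :
  training_sample m s X (fun kj : 'I_T * 'I_N => Z kj.1 kj.2) ->
  (forall w, dagger_run T eps (X ^~ w) (fun k j => Z k j w) (b0 w) (x0 w) (b w)) ->
  has_average_law P xhat (@dagger_data R N T t) (N * (stage T t).+1)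
    (fun (kj : 'I_T * 'I_N) w =>
       dagger_x T eps (X ^~ w) (fun k j => Z k j w) (x0 w) kj.1 kj.2 t) ->
  has_normal_law 0 1 X0 ->
  independent_of_family P X0
    (joint_family X (fun kj : 'I_T * 'I_N => Z kj.1 kj.2)) ->
  (forall w, ode_solution T%:R (model1 T (b w)) (X0 w) (x w)) ->
  0 <= t <= T%:R ->
  ((eps ^+ 2 * s ^+ 2 * (t ^+ 2 / 3 - 2 * t / N%:R))%:E <=
    'V_Q[xhat] - 'V_P[x ^~ t])%E.
Proof.
move=> sXZ run lawY nX0 iX0 ode tT.
have [iT it ti] := stage_bounds T0 tT; set i := stage T t in lawY iT it ti.
have iti : i%:R <= t <= i.+1%:R by rewrite it ti.
have [t0 tT'] := andP tT.
have NR0 : 0 < N%:R :> R by rewrite ltr0n.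
set a := h T t / h T 0.
have [|_ _ ->] := @fresh_init_moments _ _ X _ X0 a
    (fun p : 'I_T * 'I_N => eps / N%:R * model1_flow T (dagger_weight T p.1) 0 i t) (x ^~ t) sXZ nX0 iX0.
  by move=> w; exact: (dagger_stateE T0 N0 (run w) iT iti (ode w)).
(* Coefficient of the noises of row 0 in a path started at k. It vanishes at k = 0, so in [f] the
   own noise of a path never overlaps with the inherited ones, and the lower bound may keep the own
   noise alone. *)
pose e0 (k : nat) := h T t / h T k%:R * (eps / N%:R) * k%:R.
pose f (q p : 'I_T * 'I_N) := (if p.1 == 0%N :> nat then e0 q.1 else 0) +
  (if p == q then eps * (t - q.1%:R) else 0).
have mom (q : 'I_T * 'I_N) := @training_moments _ _ X _ q.2 a (f q)
  (fun w => dagger_x T eps (X ^~ w) (fun k j => Z k j w) (x0 w) q.1 q.2 t) sXZ.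
have {}mom (q : 'I_T * 'I_N) : @dagger_data R N T t q ->
    [/\ (fun w => dagger_x T eps (X ^~ w) (fun k j => Z k j w) (x0 w) q.1 q.2 t) \in Lfun P 2%:E,
     'E_P[(fun w => dagger_x T eps (X ^~ w) (fun k j => Z k j w) (x0 w) q.1 q.2 t)]%E =
       (m * \sum_p f q p)%:E &
     'V_P[(fun w => dagger_x T eps (X ^~ w) (fun k j => Z k j w) (x0 w) q.1 q.2 t)]%E =
       (a ^+ 2 + s ^+ 2 * \sum_p f q p ^+ 2)%:E].
  move=> _; apply: mom => w.
  rewrite (dagger_xE T0 N0 (run w))// -addrA; congr (_ + _).
  under [RHS]eq_bigr do rewrite mulrDl.
  rewrite big_split/= (sum_pair_row (e0 q.1) (fun k j => Z k j w) T0).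
  by rewrite (sum_delta q (eps * (t - q.1%:R)) (fun p : 'I_T * 'I_N => Z p.1 p.2 w)).
have cK : #|@dagger_data R N T t| = (N * i.+1)%N.
  by rewrite -(card_dagger_data N iT); apply: eq_card => p; rewrite /dagger_data unfold_in.
rewrite -cK in lawY.
have := average_law_variance_ge lawY
  (mu := fun q => m * \sum_p f q p) (v := fun q => a ^+ 2 + s ^+ 2 * \sum_p f q p ^+ 2)
  (fun q Kq => let: And3 a _ _ := mom q Kq in a)
  (fun q Kq => let: And3 _ a _ := mom q Kq in a)
  (fun q Kq => let: And3 _ _ a := mom q Kq in a).
rewrite cK => VQ.
have low : a ^+ 2 + s ^+ 2 * eps ^+ 2 * (t ^+ 2 / 3) <=
    (N * i.+1)%:R^-1 * \sum_(q | @dagger_data R N T t q) (a ^+ 2 + s ^+ 2 * \sum_p f q p ^+ 2).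
  apply: (@le_trans _ _ ((N * i.+1)%:R^-1 * \sum_(q | @dagger_data R N T t q)
      (a ^+ 2 + s ^+ 2 * (eps * (t - q.1%:R)) ^+ 2))); last first.
    rewrite ler_wpM2l ?invr_ge0//; apply: ler_sum => q _.
    rewrite lerD2l ler_wpM2l ?sqr_ge0// (bigD1 q)//=.
    have -> : f q q = eps * (t - q.1%:R).
      rewrite /f eqxx; case: eqP => [->|_]; rewrite ?add0r//.
      by rewrite /e0 mulr0 add0r.
    by rewrite lerDl sumr_ge0// => p _; exact: sqr_ge0.
  have -> : \sum_(q | @dagger_data R N T t q) (a ^+ 2 + s ^+ 2 * (eps * (t - q.1%:R)) ^+ 2) =
      N%:R * \sum_(k < i.+1) (a ^+ 2 + s ^+ 2 * (eps * (t - k%:R)) ^+ 2).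
    rewrite (big_ord_widen _ (fun k => a ^+ 2 + s ^+ 2 * (eps * (t - k%:R)) ^+ 2) iT).
    rewrite [X in _ * X]big_mkcond/=.
    rewrite -(@sum_pair_fst _ T N (fun k => if (k < i.+1)%N then a ^+ 2 + s ^+ 2 * (eps * (t - k%:R)) ^+ 2 else 0)).
    by rewrite [LHS]big_mkcond/=.
  rewrite natrM invfM [leRHS]mulrACA mulVf ?gt_eqF// mul1r.
  have := mean_sqr_sub_nat it.
  have -> : \sum_(k < i.+1) (a ^+ 2 + s ^+ 2 * (eps * (t - k%:R)) ^+ 2) =
      i.+1%:R * a ^+ 2 + s ^+ 2 * eps ^+ 2 * \sum_(k < i.+1) (t - k%:R) ^+ 2.
    rewrite big_split/= sumr_const card_ord mulr_sumr; congr (_ + _).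
      by rewrite mulr_natl.
    by apply: eq_bigr => k _; ring.
  move: (\sum_(k < i.+1) _) => S avg.
  rewrite mulrDr mulKf ?pnatr_eq0// lerD2l [leRHS]mulrCA ler_wpM2l//.
  by rewrite mulr_ge0 ?sqr_ge0.
have up : \sum_(p : 'I_T * 'I_N) (eps / N%:R * model1_flow T (dagger_weight T p.1) 0 i t) ^+ 2 <=
    eps ^+ 2 * (2 * t / N%:R).
  rewrite (@sum_pair_fst _ T N (fun k => (eps / N%:R * model1_flow T (dagger_weight T k) 0 i t) ^+ 2)).
  rewrite (eq_bigr (fun k : 'I_T => (eps / N%:R) ^+ 2 * model1_flow T (dagger_weight T k) 0 i t ^+ 2)); last first.
    by move=> k _; rewrite exprMn.
  rewrite -mulr_sumr; have := dagger_flow_sqr_sum iT iti; move: (\sum_(k < T) _) => S S2.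
  have -> : N%:R * ((eps / N%:R) ^+ 2 * S) = eps ^+ 2 * (S / N%:R).
    by field; rewrite gt_eqF.
  by rewrite ler_wpM2l ?sqr_ge0// ler_wpM2r// invr_ge0.
have : ((a ^+ 2 + s ^+ 2 * eps ^+ 2 * (t ^+ 2 / 3))%:E <= 'V_Q[xhat])%E.
  by apply: le_trans VQ; rewrite lee_fin.
rewrite leeBrDr// => {VQ low}; apply: le_trans; rewrite -EFinD lee_fin.
have := ler_wpM2l (sqr_ge0 s) up; move: (\sum_p _) => S.
move: (a ^+ 2) (t ^+ 2 / 3) (2 * t / N%:R) => A B C h1.
have -> : eps ^+ 2 * s ^+ 2 * (B - C) + (A + s ^+ 2 * S) =
  A + s ^+ 2 * eps ^+ 2 * B + (s ^+ 2 * S - s ^+ 2 * (eps ^+ 2 * C)) by ring.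
by rewrite gerDl subr_le0.
Qed.

Lemma pops_distribution (X : 'I_N -> {RV P >-> R}) (Z : nat -> 'I_N -> {RV P >-> R})
    (x0 : W -> nat -> 'I_N -> R -> R) (b : W -> nat -> R -> R)
    (t : R) (xhat : {RV Q >-> R}) (X0 : {RV P >-> R}) (x : W -> R -> R) :
  training_sample m s X (fun kj : 'I_T * 'I_N => Z kj.1 kj.2) ->
  (forall w, pops_run T eps (X ^~ w) (fun k j => Z k j w) (x0 w) (b w)) ->
  has_average_law P xhat xpredT N
    (fun (j : 'I_N) w => pops_x T eps (fun k j => Z k j w) (x0 w) T.-1 j t) ->
  has_normal_law 0 1 X0 ->
  independent_of_family P X0
    (joint_family X (fun kj : 'I_T * 'I_N => Z kj.1 kj.2)) ->
  (forall w, ode_solution T%:R (model1 T (b w T.-1)) (X0 w) (x w)) ->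
  0 <= t <= T%:R ->
  'E_Q[xhat]%E = 'E_P[x ^~ t]%E /\
  (`|'V_Q[xhat] - 'V_P[x ^~ t]| <= (eps ^+ 2 * s ^+ 2)%:E)%E.
Proof.
move=> sXZ run lawY nX0 iX0 ode tT.
have [iT it ti] := stage_bounds T0 tT; set i := stage T t in iT it ti.
have iti : i%:R <= t <= i.+1%:R by rewrite it ti.
have [t0 tT'] := andP tT.
have NR0 : 0 < N%:R :> R by rewrite ltr0n.
(* [stage] is the integer part of t except at t = T, so the right endpoint is attained only on the
   last stage. *)
have ti' : (i < T.-1)%N -> t < i.+1%:R.
  move=> iT1; rewrite ltNge; apply/negP => it1.
  have tE : t = i.+1%:R by apply/eqP; rewrite eq_le ti it1.
  have iT2 : (i.+1 < T)%N by rewrite -(prednK T0) ltnS.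
  have : i = i.+1.
    rewrite -{1}(@stageE _ T t i.+1 iT2)//.
    by rewrite tE lexx ltr_nat ltnSn.
  by move=> /eqP; rewrite eqn_leq ltnn andbF.
set a := h T t / h T 0.
pose g (p : 'I_T * 'I_N) := pops_past_coef T N eps i t p.1.
pose f1 (p : 'I_T * 'I_N) : R := if p.1 == i :> nat then eps / N%:R * (t - i%:R) else 0.
pose f2 j (p : 'I_T * 'I_N) : R := if p == (Ordinal iT, j) then eps * (t - i%:R) else 0.
have [|_ -> ->] := @fresh_init_moments _ _ X _ X0 a (fun p => g p + f1 p)
    (x ^~ t) sXZ nX0 iX0.
  by move=> w; exact: (pops_stateE T0 N0 (run w) iT iti (ode w)).
have gi (p : 'I_T * 'I_N) : p.1 = i :> nat -> g p = 0.
  by move=> pi; rewrite /g pops_past_coef0// pi.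
(* Past noises and those of stage i have disjoint supports, so their squares add up. The past part
   is identical in data and trajectory and cancels, leaving tau^2 (1 - 1 / N) with tau = t - i <=
   1. *)
have sqr1 : \sum_p (g p + f1 p) ^+ 2 = \sum_p g p ^+ 2 + \sum_p f1 p ^+ 2.
  rewrite -big_split/=; apply: eq_bigr => p _; rewrite /f1.
  by case: eqP => [/gi ->|_]; rewrite ?add0r ?addr0 ?expr0n ?add0r ?addr0.
have sqr2 j : \sum_p (g p + f2 j p) ^+ 2 = \sum_p g p ^+ 2 + \sum_p f2 j p ^+ 2.
  rewrite -big_split/=; apply: eq_bigr => p _; rewrite /f2.
  case: eqP => [->|_]; last by rewrite expr0n !addr0.
  by rewrite gi// expr0n !add0r.
have sf1 : \sum_p f1 p = eps * (t - i%:R).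
  have := @sum_pair_row i (eps / N%:R * (t - i%:R)) (fun _ _ => 1) iT.
  under eq_bigr do rewrite mulr1.
  move=> ->; rewrite sumr_const card_ord -/(N%:R).
  by field; rewrite gt_eqF.
have sf1q : \sum_p f1 p ^+ 2 = (eps * (t - i%:R)) ^+ 2 / N%:R.
  have := @sum_pair_row i ((eps / N%:R * (t - i%:R)) ^+ 2) (fun _ _ => 1) iT.
  rewrite (eq_bigr (fun p => f1 p ^+ 2)).
    move=> ->; rewrite sumr_const card_ord -/(N%:R).
    by field; rewrite gt_eqF.
  by move=> p _; rewrite mulr1 /f1; case: ifP => //; rewrite expr0n.
have [|-> ->] := average_law_const N0 lawY (M := m * (\sum_p g p + eps * (t - i%:R)))
    (V := a ^+ 2 + s ^+ 2 * (\sum_p g p ^+ 2 + (eps * (t - i%:R)) ^+ 2)).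
  move=> j; have [|? -> ->] := @training_moments _ _ X _ j a (fun p => g p + f2 j p)
    (fun w => pops_x T eps (fun k j => Z k j w) (x0 w) T.-1 j t) sXZ.
    move=> w; rewrite (pops_dataXE T0 N0 (run w) j iT iti ti'); congr (_ + _).
    under [RHS]eq_bigr do rewrite mulrDl.
    rewrite big_split/=; congr (_ + _).
    by rewrite (sum_delta _ _ (fun p : 'I_T * 'I_N => Z p.1 p.2 w)).
  by split => //; congr _%:E; rewrite ?sqr2 ?big_split/= ?sum_delta1 ?sum_delta_sqr.
rewrite big_split/= sf1 sqr1 sf1q; split => //.
rewrite lee_fin.
have tau : 0 <= t - i%:R <= 1 by rewrite subr_ge0 it lerBlDl natr1.
move: tau; move: (t - i%:R) (\sum_p _) (a ^+ 2) => tau G A /andP[tau0 tau1].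
have -> : A + s ^+ 2 * (G + (eps * tau) ^+ 2) - (A + s ^+ 2 * (G + (eps * tau) ^+ 2 / N%:R)) =
  eps ^+ 2 * s ^+ 2 * (tau ^+ 2 * (1 - N%:R^-1)) by ring.
have N1 : 0 <= 1 - N%:R^-1 :> R by rewrite subr_ge0 invf_le1// ler1n.
have N2 : 1 - N%:R^-1 <= 1 :> R by rewrite gerBl invr_ge0.
have e0 : 0 <= eps ^+ 2 * s ^+ 2 by rewrite mulr_ge0 ?sqr_ge0.
have u0 : 0 <= tau ^+ 2 * (1 - N%:R^-1) by rewrite mulr_ge0 ?sqr_ge0.
rewrite ger0_norm; last exact: mulr_ge0.
by apply: ler_piMr => //; apply: mulr_ile1; rewrite ?sqr_ge0 ?expr_le1.
Qed.

End Distributions.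

Theorem theorem1 (R : realType) (d : measure_display) (W : measurableType d)
  (P : probability W R)
  (T N : nat) (hT : (1 <= T)%N) (hN : (1 <= N)%N)
  (eps m sigma : R) (heps : 0 < eps) (hsigma : 0 <= sigma)
  (* vanilla method *)
  (Xv Zv : 'I_(N * T) -> {RV P >-> R})
  (hXZv : training_sample m sigma Xv Zv)
  (bv : W -> R -> R)
  (hv : forall w, vanilla_run eps (Xv ^~ w) (Zv ^~ w) (bv w))
  (* DAgger *)
  (Xd : 'I_N -> {RV P >-> R}) (Zd : nat -> 'I_N -> {RV P >-> R})
  (hXZd : training_sample m sigma Xd
            (fun kj : 'I_T * 'I_N => Zd kj.1 kj.2))
  (b0d : W -> R -> R) (x0d : W -> 'I_N -> R -> R) (bd : W -> R -> R)
  (hd : forall w, dagger_run T eps (Xd ^~ w) (fun k j => Zd k j w)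
                    (b0d w) (x0d w) (bd w))
  (* POPS *)
  (Xp : 'I_N -> {RV P >-> R}) (Zp : nat -> 'I_N -> {RV P >-> R})
  (hXZp : training_sample m sigma Xp
            (fun kj : 'I_T * 'I_N => Zp kj.1 kj.2))
  (x0p : W -> nat -> 'I_N -> R -> R) (bp : W -> nat -> R -> R)
  (hp : forall w, pops_run T eps (Xp ^~ w) (fun k j => Zp k j w)
                    (x0p w) (bp w))
  (* training-data state variables *)
  (d' : measure_display) (W' : measurableType d') (Q : probability W' R)
  (xhatv xhatd xhatp : R -> {RV Q >-> R})
  (hxhatv : forall t, t \in `[0, T%:R] ->
     has_average_law P (xhatv t) xpredT (N * T)
       (fun (j : 'I_(N * T)) w => vanilla_x eps (Xv ^~ w) (Zv ^~ w) j t))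
  (hxhatd : forall t, t \in `[0, T%:R] ->
     has_average_law P (xhatd t) (@dagger_data R N T t) (N * (stage T t).+1)
       (fun (kj : 'I_T * 'I_N) w =>
          dagger_x T eps (Xd ^~ w) (fun k j => Zd k j w) (x0d w)
            kj.1 kj.2 t))
  (hxhatp : forall t, t \in `[0, T%:R] ->
     has_average_law P (xhatp t) xpredT N
       (fun (j : 'I_N) w =>
          pops_x T eps (fun k j => Zp k j w) (x0p w) T.-1 j t)) :
  (* distribution difference *)
  (forall (xinit : {RV P >-> R}) (xv xd xp : R -> W -> R),
     has_normal_law 0 1 xinit ->
     independent_of_family P xinit (joint_family Xv Zv) ->
     independent_of_family P xinit
       (joint_family Xd (fun kj : 'I_T * 'I_N => Zd kj.1 kj.2)) ->
     independent_of_family P xinit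
       (joint_family Xp (fun kj : 'I_T * 'I_N => Zp kj.1 kj.2)) ->
     (forall w, ode_solution T%:R (model1 T (bv w)) (xinit w) (xv ^~ w)) ->
     (forall w, ode_solution T%:R (model1 T (bd w)) (xinit w) (xd ^~ w)) ->
     (forall w, ode_solution T%:R (model1 T (bp w T.-1)) (xinit w)
                  (xp ^~ w)) ->
     forall t : R, 0 <= t <= T%:R ->
     [/\ 'E_Q[xhatv t] = 'E_P[xv t],
         'E_Q[xhatp t] = 'E_P[xp t],
         `|'V_Q[xhatv t] - 'V_P[xv t]| =
           (eps ^+ 2 * sigma ^+ 2 * (1 - 1 / (N * T)%:R) * t ^+ 2)%:E,
         'V_Q[xhatd t] - 'V_P[xd t] >=
           (eps ^+ 2 * sigma ^+ 2 * (t ^+ 2 / 3 - 2 * t / N%:R))%:E &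
         `|'V_Q[xhatp t] - 'V_P[xp t]| <= (eps ^+ 2 * sigma ^+ 2)%:E]%E) /\
  (* performance difference *)
  (forall (xinit : R) (xo : R -> R) (xv xd xp : R -> W -> R),
     ode_solution T%:R (optimal_feedback T) xinit xo ->
     (forall w, ode_solution T%:R (model1 T (bv w)) xinit (xv ^~ w)) ->
     (forall w, ode_solution T%:R (model1 T (bd w)) xinit (xd ^~ w)) ->
     (forall w, ode_solution T%:R (model1 T (bp w T.-1)) xinit (xp ^~ w)) ->
     let J (u : R -> R -> R) (x : R -> R) : R :=
       lqr_cost T 0 (fun t => u t (x t)) x in
     let Jo := J (optimal_feedback T) xo in
     let Jv w := J (model1 T (bv w)) (xv ^~ w) in
     let Jd w := J (model1 T (bd w)) (xd ^~ w) in
     let Jp w := J (model1 T (bp w T.-1)) (xp ^~ w) in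
     [/\ 'E_P[Jv] - Jo%:E =
           ((T%:R ^+ 2 + 1) * (m ^+ 2 + sigma ^+ 2 / (N * T)%:R)
              * eps ^+ 2)%:E,
         'E_P[Jd] - Jo%:E >=
           ((T%:R ^+ 2 * m ^+ 2 / 4 + T%:R * sigma ^+ 2 / (3 * N%:R))
              * eps ^+ 2)%:E &
         'E_P[Jp] - Jo%:E <=
           (3 * (m ^+ 2 + sigma ^+ 2 / N%:R) * eps ^+ 2)%:E]%E).
Proof.
have noise_indep := @training_noise_independent R d W P m sigma.
split.
  move=> xinit xv xd xp nX iv id ip ov od op t tT.
  have [Ev VQ VP] := vanilla_distribution (x := fun w => xv ^~ w) hT hN hsigma hXZv hv
    (hxhatv t tT) nX iv ov tT.
  have Dd := dagger_distribution (x := fun w => xd ^~ w) hT hN hsigma hXZd hd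
    (hxhatd t tT) nX id od tT.
  have [Ep Dp] := pops_distribution (x := fun w => xp ^~ w) hT hN hsigma hXZp hp
    (hxhatp t tT) nX ip op tT.
  split => //; rewrite VQ VP -EFinB abse_EFin; congr _%:E.
  have n1 : (N * T)%:R^-1 <= 1 :> R.
    by rewrite invf_le1 ?ltr0n ?ler1n muln_gt0 hN.
  rewrite ger0_norm.
    by rewrite div1r; move: (_ / _) (_%:R^-1) => a n; ring.
  rewrite opprD addrACA subrr add0r -mulrBr mulr_ge0 ?sqr_ge0//.
  by rewrite subr_ge0 ler_piMr ?sqr_ge0.
move=> xinit xo xv xd xp oo ov od op J Jo Jv Jd Jp.
(* The optimal feedback is the Model 1 controller with b = 0, so the general cost formula applies
   with all c_k = 0. *)
have JoE : Jo = xinit ^+ 2 / riccati T 0.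
  have oo' : ode_solution T%:R (model1 T (fun=> 0)) xinit xo.
    rewrite (_ : model1 T _ = optimal_feedback T)//.
    by apply/funext => t; apply/funext => x; rewrite /model1 addr0.
  transitivity (lqr_cost T 0 (fun t => model1 T (fun=> 0) t (xo t)) xo).
    rewrite /Jo /J; congr (lqr_cost _ _ _ _).
    by apply/funext => t; rewrite /model1 addr0.
  rewrite (@model1_cost R T (fun=> 0) (fun=> 0) xinit xo hT oo').
    by rewrite big1 ?addr0// => k _; rewrite expr0n mul0r.
  by move=> k r _ _; rewrite mul0r.
have Ev := @expected_model1_cost R d W P T hT m sigma _ Zv
  (fun _ j => vanilla_coef eps j) bv xinit (fun w => xv ^~ w) hsigma
  (sample_noise hXZv) (fun j k => noise_indep _ _ _ _ j k hXZv) ov.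
have Ed := @expected_model1_cost R d W P T hT m sigma _ (fun p : 'I_T * 'I_N => Zd p.1 p.2)
  (fun l p => eps / N%:R * dagger_weight T p.1 l) bd xinit (fun w => xd ^~ w) hsigma
  (sample_noise hXZd) (fun j k => noise_indep _ _ _ _ j k hXZd) od.
have Ep := @expected_model1_cost R d W P T hT m sigma _ (fun p : 'I_T * 'I_N => Zp p.1 p.2)
  (fun l p => eps / N%:R * pops_weight T p.1 l) (fun w => bp w T.-1) xinit
  (fun w => xp ^~ w) hsigma
  (sample_noise hXZp) (fun j k => noise_indep _ _ _ _ j k hXZp) op.
have inT (l : nat) (r : R) : (l < T)%N -> l%:R <= r < l.+1%:R -> r \in `[0, T%:R].
  move=> lT /andP[lr rl]; rewrite in_itv/= (le_trans _ lr)//=.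
  by rewrite (le_trans (ltW rl))// ler_nat.
split.
- rewrite Ev => [|w l r lT lr]; last first.
    exact: (vanilla_fit hT hN (hv w)) (inT _ _ lT lr).
  by rewrite JoE -EFinB vanilla_cost_sum// addrAC subrr add0r.
- rewrite Ed => [|w l r lT lr]; last first.
    rewrite (dagger_fitE hN (hd w) lT lr); congr (_ / _).
    by apply: eq_bigr => p _; rewrite mulrAC.
  by rewrite JoE -EFinB addrAC subrr add0r lee_fin dagger_cost_sum.
- rewrite Ep => [|w l r lT lr]; last first.
    have lT1 : (l <= T.-1)%N by rewrite -ltnS prednK.
    have T1 : (T.-1 < T)%N by rewrite prednK.
    rewrite (pops_fitE hN (hp w) T1 lT1 lr); congr (_ / _).
    by apply: eq_bigr => p _; rewrite mulrAC.
  by rewrite JoE -EFinB addrAC subrr add0r lee_fin pops_cost_sum.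
Qed.
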